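(* Let $X=\mathbb{P}^1$ over the finite field $\mathbb{F}$ with $p$ elements, $K=\mathbb{F}(t)$, $\mathfrak{A}=\mathbb{M}_2(K)$, and fix a place $Q$ of degree $1$. For a place $P$ of $X$ let $N_P$ be the infinite matrix $\big(N_P(\mathfrak{D}_{iQ},\mathfrak{D}_{jQ})\big)_{i,j\in\mathbb{N}}$. Then for every place $P$ the matrix $N_P$ depends only on $d=\deg(P)$; writing $N_d$ for it (so $N_1=N_Q$) and setting $N_0=I$ (the identity matrix), for every $d\ge1$ $$N_d=N_1^d-\sum_{i=1}^{\lfloor d/2\rfloor}\binom{d}{i}p^iN_{d-2i}.$$
   Context: An $X$-order is a locally free subsheaf of $\mathcal{O}_X$-algebras of the constant sheaf $\mathfrak{A}$ with generic fibre $\mathfrak{A}$; maximal if maximal at every place; two are isomorphic if conjugate by an element of $\mathrm{GL}_2(K)$. For a divisor $B$, $\mathfrak{L}^B(V)=\{f\in K:\mathrm{div}(f)|_V+B|_V\ge0\}\cup\{0\}$ and $\mathfrak{D}_B=\begin{pmatrix}\mathcal{O}_X&\mathfrak{L}^B\\ \mathfrak{L}^{-B}&\mathcal{O}_X\end{pmatrix}$. For a place $P$, the local Bruhat–Tits tree $T_P$ has as vertices the maximal $\mathcal{O}_P$-orders of $\mathbb{M}_2(K_P)$, adjacent when in a suitable basis they are $\mathbb{M}_2(\mathcal{O}_P)$ and $\begin{pmatrix}\mathcal{O}_P&\pi_P^{-1}\mathcal{O}_P\\ \pi_P\mathcal{O}_P&\mathcal{O}_P\end{pmatrix}$. The $P$-neighbors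 of a maximal $X$-order $\mathfrak{D}$ are the maximal $X$-orders coinciding with $\mathfrak{D}$ at all places other than $P$ whose completion at $P$ is adjacent to $\mathfrak{D}_P$ in $T_P$; $N_P(\mathfrak{D},\mathfrak{D}')$ is the number of $P$-neighbors of $\mathfrak{D}$ isomorphic to $\mathfrak{D}'$. Products of these infinite matrices are computed entrywise as the usual (finite) sums. *)

(* Defs.v *)
From HB Require Import structures.
From mathcomp Require Import all_boot all_order all_algebra fraction.
From Stdlib Require Import ClassicalEpsilon.
Set Implicit Arguments. Unset Strict Implicit. Unset Printing Implicit Defensive.
Import Order.TTheory GRing.Theory Num.Theory.
Local Open Scope ring_scope.

Section Defs.
Variable p : nat.

Definition Fp := 'F_p.
Definition Fpoly := {poly 'F_p}.
Definition K := {fraction {poly 'F_p}}.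
Definition Mat := 'M[K]_2.

Definition tf (a : {poly 'F_p}) : K := @FracField.tofrac _ a.

(* Places of X = P^1 over F_p: [Some q] for q monic irreducible in F_p[t]
   (finite places), [None] for the place at infinity. *)
Definition is_place (P : option {poly 'F_p}) : Prop :=
  match P with
  | Some q => q \is monic /\ irreducible_poly q
  | None => True
  end.

Definition place_deg (P : option {poly 'F_p}) : nat :=
  match P with
  | Some q => (size q).-1
  | None => 1%N
  end.

Definition locO (P : option {poly 'F_p}) (f : K) : Prop :=
  match P with
  | Some q => exists a b : {poly 'F_p},
      b != 0 /\ ~~ (q %| b)%R /\ f = tf a / tf b
  | None => exists a b : {poly 'F_p},
      b != 0 /\ (size a <= size b)%N /\ f = tf a / tf b
  end.

Definition unif (P : option {poly 'F_p}) : K :=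
  match P with
  | Some q => tf q
  | None => (tf 'X)^-1
  end.

Definition inpow (P : option {poly 'F_p}) (n : int) (f : K) : Prop :=
  locO P (f * (unif P) ^ (- n)).

Definition mset := Mat -> Prop.
Definition mseteq (S T : mset) : Prop := forall x, S x <-> T x.
Definition msubset (S T : mset) : Prop := forall x, S x -> T x.

(* O_P-orders of M_2(K): O_P-lattices (finitely generated O_P-submodules
   spanning M_2(K) over K) which are subrings *)
Definition is_local_order (P : option {poly 'F_p}) (S : mset) : Prop :=
  [/\ [/\ S 1,
          (forall x y, S x -> S y -> S (x - y)) &
          (forall x y, S x -> S y -> S (x * y))],
      (forall (a : K) x, locO P a -> S x -> S (a *: x)),
      (exists s : seq Mat, (forall x, x \in s -> S x) /\
         forall x, S x -> exists c : 'I_(size s) -> K,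
           (forall i, locO P (c i)) /\ x = \sum_(i < size s) c i *: s`_i)
    & (forall m : Mat, exists a : K, a != 0 /\ S (a *: m))].

Definition is_local_max_order (P : option {poly 'F_p}) (S : mset) : Prop :=
  is_local_order P S /\
  forall T, is_local_order P T -> msubset S T -> mseteq T S.

Definition valmat (P : option {poly 'F_p}) (a b c d : int) : mset :=
  fun m => [/\ inpow P a (m 0 0), inpow P b (m 0 1),
               inpow P c (m 1 0) & inpow P d (m 1 1)].

Definition M2O (P : option {poly 'F_p}) : mset := valmat P 0 0 0 0.

(* adjacency in the Bruhat-Tits tree at P: in a suitable basis the two
   maximal orders are M_2(O_P) and [[O_P, pi^-1 O_P],[pi O_P, O_P]] *)
Definition tree_adj (P : option {poly 'F_p}) (S T : mset) : Prop :=
  exists g : Mat, g \in unitmx /\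
    mseteq S (fun x => M2O P (g * x * g^-1)) /\
    mseteq T (fun x => valmat P 0 (-1) 1 0 (g * x * g^-1)).

(* X-orders, described by their stalks D_P (P a place): a family of
   O_P-orders in M_2(K), equal to M_2(O_P) outside a finite set of places *)
Definition Xfam := option {poly 'F_p} -> mset.

Definition is_Xorder (D : Xfam) : Prop :=
  (forall P, is_place P -> is_local_order P (D P)) /\
  exists s : seq (option {poly 'F_p}),
    forall P, is_place P -> P \notin s -> mseteq (D P) (M2O P).

Definition is_max_Xorder (D : Xfam) : Prop :=
  is_Xorder D /\ forall P, is_place P -> is_local_max_order P (D P).

Definition Xeq (D D' : Xfam) : Prop :=
  forall P, is_place P -> mseteq (D P) (D' P).

Definition Xiso (D D' : Xfam) : Prop :=
  exists g : Mat, g \in unitmx /\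
    forall P, is_place P -> mseteq (D' P) (fun x => D P (g^-1 * x * g)).

Definition P_neighbor (P : option {poly 'F_p}) (D D' : Xfam) : Prop :=
  is_max_Xorder D' /\
  (forall R, is_place R -> R <> P -> mseteq (D' R) (D R)) /\
  tree_adj P (D P) (D' P).

Definition nthX (l : seq Xfam) (i : nat) : Xfam := nth (fun _ _ => False) l i.

Definition count_is (A : Xfam -> Prop) (n : nat) : Prop :=
  exists l : seq Xfam,
    [/\ size l = n,
        (forall i, (i < size l)%N -> A (nthX l i)),
        (forall i j, (i < size l)%N -> (j < size l)%N ->
            Xeq (nthX l i) (nthX l j) -> i = j)
      & (forall D, A D -> exists2 i, (i < size l)%N & Xeq D (nthX l i))].

Definition N_is (P : option {poly 'F_p}) (D D' : Xfam) (n : nat) : Prop :=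
  count_is (fun D'' => P_neighbor P D D'' /\ Xiso D'' D') n.

Definition D_iQ (Q : option {poly 'F_p}) (i : nat) : Xfam :=
  fun P => if P == Q then valmat P 0 (- (i%:Z)) (i%:Z) 0 else M2O P.

End Defs.

Definition imat := nat -> nat -> int.

Definition fsum (f : nat -> int) : int :=
  match excluded_middle_informative
          (exists M : nat, forall k, (M <= k)%N -> f k = 0) with
  | left h => let M := proj1_sig (constructive_indefinite_description _ h) in
              (\sum_(k < M) f k)%R
  | right _ => 0
  end.

Definition imul (A B : imat) : imat := fun i j => fsum (fun k => A i k * B k j).
Definition iid : imat := fun i j => (i == j)%:Z.
Fixpoint ipow (A : imat) (n : nat) : imat :=
  match n with 0 => iid | n'.+1 => imul (ipow A n') A end.

(* Main.v *)
Require Import Defs.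
From HB Require Import structures.
From mathcomp Require Import all_boot all_order all_algebra fraction.
From mathcomp Require Import qpoly zify ring.
From Stdlib Require Import Classical ClassicalEpsilon.
Set Implicit Arguments. Unset Strict Implicit. Unset Printing Implicit Defensive.
Import GRing.Theory.
Local Open Scope ring_scope.

(** Formally [N_d] behaves like [a^d + b^d] with [a + b = N_1] and [a b = p]. This is the source of
    the two-term recurrence, and pairing the terms [k] and [d - k] of [(a + b)^d] gives the formula.
    At [d = 0] this power sum would be [2], whereas [N_0] is the identity. Hence the [2 p] in
    [N_1 N_1]; and the middle binomial coefficient, which has no partner, is counted once.

    Reduction shows that minima exist but gives no closed form for them in terms of the slope [l],
    so they are counted on average. If [2 m < d - i], then [m] lies below the second minimum, the
    vectors of weight at most [m] are the multiples of the first basis vector, and their number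
    [p^(m + 1 - m1)] (exponent truncated at [0]) depends on [m1] alone. Conversely a nonzero pair of
    small degrees belongs to at most one slope. The sums obtained are exponential in [m1], and
    differences in [m] isolate the slopes with a given [m1].

    Every local statement holds only up to a scalar, because homothetic lattices have the same
    endomorphisms. *)

(** A maximal [X]-order is the endomorphism order of a lattice, given at each
    place by a matrix [a R] as [{x | a R x (a R)^-1 integral}].  The [P]-neighbors
    correspond to the points of the projective line over the residue field of [P]:
    the point at infinity gives the type [i + d], and an affine point [l] (a
    polynomial of degree less than [d = deg q]) leads to the lattice
    [{(u, v) | u + l v = 0 mod q}].  Reducing a basis of it with respect to the
    weight [max (deg u - i, deg v)] gives successive minima [m1 <= m2] with
    [m1 + m2 = d - i], and the neighbor has type [m2 - m1].  Counting the pairs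
    [((u, v), l)] with [(u, v)] of weight at most [m] in two ways yields the number
    of [l] with a given [m1], hence explicit matrices [N_d].  They satisfy
    [N_e N_1 = N_(e+1) + p N_(e-1)] for [e >= 2] and [N_1 N_1 = N_2 + 2 p],
    and the formula follows from Pascal's rule.

    Conjugation by [diag(y ^ i, 1)] carries [D_(iQ)] to [D_(i oo)] for every [Q] of
    degree one, so that only [Q = oo] has to be considered. *)

(** * Maximal orders over a discrete valuation ring *)

Section TwoByTwo.
Variable F : fieldType.
Implicit Types (a b c d k : F) (g x y : 'M[F]_2).

Definition mx2 a b c d : 'M[F]_2 :=
  \matrix_(i, j) if i == 0 then (if j == 0 then a else b)
                 else (if j == 0 then c else d).

Lemma ord2P (P : 'I_2 -> Prop) : P 0 -> P 1 -> forall i, P i.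
Proof.
by move=> P0 P1 [[|[|//]] lt_i]; [move: P0 | move: P1];
  congr P; apply: val_inj.
Qed.

Lemma mx2_00 a b c d : mx2 a b c d 0 0 = a. Proof. by rewrite mxE. Qed.
Lemma mx2_01 a b c d : mx2 a b c d 0 1 = b. Proof. by rewrite mxE. Qed.
Lemma mx2_10 a b c d : mx2 a b c d 1 0 = c. Proof. by rewrite mxE. Qed.
Lemma mx2_11 a b c d : mx2 a b c d 1 1 = d. Proof. by rewrite mxE. Qed.
Definition mx2C := (mx2_00, mx2_01, mx2_10, mx2_11).

Lemma eq_mx2 x y : x 0 0 = y 0 0 -> x 0 1 = y 0 1 -> x 1 0 = y 1 0 ->
  x 1 1 = y 1 1 -> x = y.
Proof. by move=> *; apply/matrixP; apply: ord2P; apply: ord2P. Qed.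

Lemma mx2_eta x : x = mx2 (x 0 0) (x 0 1) (x 1 0) (x 1 1).
Proof. by apply: eq_mx2; rewrite mx2C. Qed.

Lemma mx2M a b c d a' b' c' d' : mx2 a b c d * mx2 a' b' c' d' =
  mx2 (a * a' + b * c') (a * b' + b * d') (c * a' + d * c') (c * b' + d * d').
Proof. by apply: eq_mx2; rewrite mxE big_ord_recl big_ord1 !mxE. Qed.

Lemma mx2_1 : 1 = mx2 1 0 0 1.
Proof. by apply: eq_mx2; rewrite !mxE. Qed.

Lemma mx2Z k a b c d : k *: mx2 a b c d = mx2 (k * a) (k * b) (k * c) (k * d).
Proof. by apply: eq_mx2; rewrite !mxE. Qed.

Lemma unit_inv_of_mul x y : x * y = 1 -> x \in unitmx /\ x^-1 = y.
Proof.
move=> xy1; have [ux _] := mulmx1_unit xy1; split=> //.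
by rewrite -[LHS]mulr1 -xy1 mulKr.
Qed.

Lemma mx2V a b c d : a * d - b * c != 0 ->
  mx2 a b c d \in unitmx /\
  (mx2 a b c d)^-1 = (a * d - b * c)^-1 *: mx2 d (- b) (- c) a.
Proof.
move=> nz; apply: unit_inv_of_mul.
rewrite mx2Z mx2M mx2_1; congr mx2; field => //.
Qed.

Lemma unitmx2 a b c d : (mx2 a b c d \in unitmx) = (a * d - b * c != 0).
Proof.
apply/idP/idP => [u|/mx2V[]//]; apply/eqP => e.
have : mx2 a b c d * mx2 d (- b) (- c) a = 0.
  rewrite mx2M; apply: eq_mx2; rewrite mx2C mxE; first [by ring | rewrite -e; ring].
move/(congr1 (fun m => (mx2 a b c d)^-1 * m)); rewrite mulKr // mulr0.
move=> h; have := congr1 (fun m : 'M__ => m 0 0) h.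
have := congr1 (fun m : 'M__ => m 0 1) h.
have := congr1 (fun m : 'M__ => m 1 0) h.
have := congr1 (fun m : 'M__ => m 1 1) h.
rewrite !mx2C !mxE => a0 /eqP; rewrite oppr_eq0 => /eqP c0 /eqP.
rewrite oppr_eq0 => /eqP b0 d0; move: u; rewrite a0 b0 c0 d0.
have -> : mx2 0 0 0 0 = 0 by apply: eq_mx2; rewrite mx2C mxE.
by rewrite unitmxE det0 unitr0.
Qed.

Lemma invZ k x : k != 0 -> x \in unitmx ->
  k *: x \in unitmx /\ (k *: x)^-1 = k^-1 *: x^-1.
Proof.
move=> k0 ux; apply: unit_inv_of_mul.
by rewrite -scalerAl -scalerAr scalerA divff // scale1r mulrV.
Qed.

End TwoByTwo.

Section Dvr.
Variables (F : fieldType) (O : F -> Prop) (pi : F).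
Implicit Types (a b c d k f : F) (g x y : 'M[F]_2).

(** A discrete valuation ring described without a valuation: totality makes it a valuation ring,
    [dvr_div_unif] says that an element not divisible by [pi] is a unit, and [dvr_bound] that powers
    of [pi] clear every denominator. All of this can be checked on fractions of polynomials, alike
    at finite places and at infinity. *)
Record is_dvr : Prop := IsDvr {
  dvr1 : O 1;
  dvrB : forall a b, O a -> O b -> O (a - b);
  dvrM : forall a b, O a -> O b -> O (a * b);
  dvr_total : forall a, O a \/ O a^-1;
  unif_neq0 : pi != 0;
  dvr_unif : O pi;
  dvr_unifV : ~ O pi^-1;
  dvr_div_unif : forall a, O a -> ~ O (a / pi) -> O a^-1;
  dvr_bound : forall a, exists n, O (a * pi ^+ n)
}.

Definition intM x : Prop := forall i j, O (x i j).
Definition intGL g : Prop := [/\ g \in unitmx, intM g & intM g^-1].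
(** The endomorphism ring of the lattice [g^-1 O^2]. A left factor of [g] in [GL_2(O)] or a scalar
    leaves it unchanged, while a right factor conjugates it. *)
Definition conj_order g : 'M[F]_2 -> Prop := fun x => intM (g * x * g^-1).

(* [is_order (locO P)] unfolds to [is_local_order P]. *)
Definition is_order (S : 'M[F]_2 -> Prop) : Prop :=
  [/\ [/\ S 1,
          (forall x y, S x -> S y -> S (x - y)) &
          (forall x y, S x -> S y -> S (x * y))],
      (forall a x, O a -> S x -> S (a *: x)),
      (exists s : seq 'M[F]_2, (forall x, x \in s -> S x) /\
         forall x, S x -> exists c : 'I_(size s) -> F,
           (forall i, O (c i)) /\ x = \sum_(i < size s) c i *: s`_i)
    & (forall m, exists a : F, a != 0 /\ S (a *: m))].

Hypothesis dvrO : is_dvr.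

Lemma dvr0 : O 0. Proof. by rewrite -(subrr 1); apply: (dvrB dvrO); apply: dvr1 dvrO. Qed.
Lemma dvrN a : O a -> O (- a).
Proof. by move=> Oa; rewrite -sub0r; apply: (dvrB dvrO) => //; apply: dvr0. Qed.
Lemma dvrD a b : O a -> O b -> O (a + b).
Proof. by move=> Oa Ob; rewrite -[b]opprK; apply: (dvrB dvrO) => //; apply: dvrN. Qed.
Lemma dvrX a n : O a -> O (a ^+ n).
Proof.
move=> Oa; elim: n => [|n IH]; first by rewrite expr0; apply: dvr1 dvrO.
by rewrite exprS; apply: (dvrM dvrO).
Qed.

Lemma dvr_sum (I : finType) (f : I -> F) : (forall i, O (f i)) -> O (\sum_i f i).
Proof. by move=> Of; apply: big_ind => //; [apply: dvr0 | apply: dvrD]. Qed.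

Lemma intM_mx2 a b c d : O a -> O b -> O c -> O d -> intM (mx2 a b c d).
Proof. by move=> *; apply: ord2P; apply: ord2P; rewrite mx2C. Qed.

Lemma intMM x y : intM x -> intM y -> intM (x * y).
Proof.
by move=> ix iy i j; rewrite mxE; apply: dvr_sum => k; apply: (dvrM dvrO).
Qed.

Lemma intGL_mx2 a b c d : O a -> O b -> O c -> O d ->
  a * d - b * c != 0 -> O (a * d - b * c)^-1 -> intGL (mx2 a b c d).
Proof.
move=> Oa Ob Oc Od nz Odet; have [u v] := mx2V nz; split=> //.
  exact: intM_mx2.
by rewrite v mx2Z; apply: intM_mx2; apply: (dvrM dvrO) => //; apply: dvrN.
Qed.

Lemma intGL1 : intGL 1.
Proof.
rewrite mx2_1; apply: intGL_mx2; rewrite ?mulr1 ?mul0r ?subr0 ?invr1 ?oner_neq0 //;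
  first [exact: dvr1 dvrO | exact: dvr0].
Qed.

Lemma conj_order_GL g h x : h \in unitmx -> intGL g ->
  conj_order (g * h) x <-> conj_order h x.
Proof.
move=> uh [ug ig ivg]; rewrite /conj_order invrM //; split=> ix.
  have -> : h * x * h^-1 = g^-1 * (g * h * x * (h^-1 * g^-1)) * g.
    by rewrite !mulrA mulVr // mul1r mulrVK.
  by apply: intMM => //; apply: intMM.
have -> : g * h * x * (h^-1 * g^-1) = g * (h * x * h^-1) * g^-1 by rewrite !mulrA.
by apply: intMM => //; apply: intMM.
Qed.

Lemma conj_order_scale k h x : k != 0 -> h \in unitmx ->
  conj_order (k *: h) x <-> conj_order h x.
Proof.
move=> k0 uh; rewrite /conj_order; have [_ ->] := invZ k0 uh.
by rewrite -!scalerAl -scalerAr scalerA divff // scale1r.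
Qed.

Lemma conj_order1 x : conj_order 1 x <-> intM x.
Proof. by rewrite /conj_order mul1r invr1 mulr1. Qed.

Lemma conj_orderM g h x : g \in unitmx -> h \in unitmx ->
  conj_order (g * h) x <-> conj_order g (h * x * h^-1).
Proof. by move=> ug uh; rewrite /conj_order invrM // !mulrA. Qed.

Lemma conj_orderMV g h x : g \in unitmx -> h \in unitmx ->
  conj_order (g * h^-1) x <-> conj_order g (h^-1 * x * h).
Proof.
by move=> ug uh; rewrite conj_orderM ?unitmx_inv // invrK.
Qed.

Lemma unitmx_invr g : g \in unitmx -> g^-1 \in unitmx.
Proof. by rewrite unitmx_inv. Qed.

Lemma conj_orderVM g h x : g \in unitmx -> h \in unitmx ->
  conj_order (g * h) x <-> conj_order g ((h^-1)^-1 * x * h^-1).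
Proof. by rewrite invrK; apply: conj_orderM. Qed.

Lemma unitmx_diag f : f != 0 -> mx2 f 0 0 1 \in unitmx.
Proof. by move=> f0; rewrite unitmx2 mulr1 mulr0 subr0. Qed.

Lemma conj_order_intGL g x : intGL g -> conj_order g x <-> intM x.
Proof. by move=> GL; rewrite -[g]mulr1 conj_order_GL ?unitmx1 // conj_order1. Qed.

Lemma min_valuation (s : seq F) : has (fun a => a != 0) s ->
  exists2 m, m \in s & m != 0 /\ forall a, a \in s -> O (a / m).
Proof.
elim: s => //= a s IH; have [hs _|/hasPn z] := boolP (has _ s).
  have [m ms [m0 Om]] := IH hs; have [Oam|Oma] := dvr_total dvrO (a / m).
    exists m; first by rewrite inE ms orbT.
    by split=> // b; rewrite inE => /predU1P[->|/Om].
  have [->|a0] := eqVneq a 0.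
    exists m; first by rewrite inE ms orbT.
    split=> // b; rewrite inE => /predU1P[->|/Om //].
    by rewrite mul0r; apply: dvr0.
  exists a; first by rewrite mem_head.
  split=> // b; rewrite inE => /predU1P[->|/Om Obm].
    by rewrite divff //; apply: dvr1 dvrO.
  have -> : b / a = (b / m) * (a / m)^-1 by field; rewrite a0 m0.
  exact: (dvrM dvrO).
rewrite orbF => a0; exists a; first by rewrite mem_head.
split=> // b; rewrite inE => /predU1P[->|/z].
  by rewrite divff //; apply: dvr1 dvrO.
by rewrite negbK => /eqP->; rewrite mul0r; apply: dvr0.
Qed.

Definition entries g : seq F := [:: g 0 0; g 0 1; g 1 0; g 1 1].

Lemma mem_entries g i j : g i j \in entries g.
Proof.
by move: i j; apply: ord2P; apply: ord2P; rewrite !inE eqxx ?orbT.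
Qed.

(* If [g] normalises the integral matrices, scale it so that its entries are
   integral and one of them is [1].  The entries of [g E_ij g^-1] are the
   products of an entry of [g] and an entry of its adjugate divided by the
   determinant, so that the inverse of the determinant is integral. *)
Lemma normalizer_intM g : g \in unitmx ->
  (forall x, intM x -> conj_order g x) ->
  exists2 k, k != 0 & intGL (k *: g).
Proof.
move=> ug norm.
have /min_valuation[m mg [m0 Om]] : has (fun a => a != 0) (entries g).
  apply/negPn/negP => /hasPn z; move: ug; rewrite (mx2_eta g) unitmx2.
  have g0 i j : g i j = 0 by apply/eqP; rewrite -[_ == _]negbK; apply/z/mem_entries.
  by rewrite !g0 mulr0 subr0 eqxx.
exists m^-1; rewrite ?invr_eq0 //.
have mV0 : m^-1 != 0 by rewrite invr_eq0.
set h := m^-1 *: g.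
have uh : h \in unitmx by case: (invZ mV0 ug).
have ih : intM h by move=> i j; rewrite mxE mulrC; apply/Om/mem_entries.
have normh x : intM x -> intM (h * x * h^-1).
  by move/norm/(conj_order_scale x mV0 ug).
have h1 : 1 \in entries h.
  have : [|| g 0 0 == m, g 0 1 == m, g 1 0 == m | g 1 1 == m].
    by move: mg; rewrite !inE !(eq_sym m).
  by rewrite !inE !mxE => /or4P[] /eqP->; rewrite mulVf ?eqxx ?orbT.
clearbody h; move: normh => {}norm.
have det0 : h 0 0 * h 1 1 - h 0 1 * h 1 0 != 0 by rewrite -unitmx2 -mx2_eta.
have [_ hV] := mx2V det0; rewrite -mx2_eta in hV.
suff Odet : O (h 0 0 * h 1 1 - h 0 1 * h 1 0)^-1.
  by rewrite (mx2_eta h); apply: intGL_mx2.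
have O0 := dvr0; have O1 := dvr1 dvrO.
set D := (_ - _)^-1 in hV *.
have n01 := norm _ (intM_mx2 O0 O1 O0 O0).
have n10 := norm _ (intM_mx2 O0 O0 O1 O0).
rewrite hV [X in X * _ * _]mx2_eta mx2Z !mx2M !(mulr0, mulr1, mul0r, addr0, add0r) in n01.
rewrite hV [X in X * _ * _]mx2_eta mx2Z !mx2M !(mulr0, mulr1, mul0r, addr0, add0r) in n10.
have fin a : a = 1 -> O (a * (D * a)) -> O D by move=> ->; rewrite mulr1 mul1r.
have finN a : a = 1 -> O (a * (D * - a)) -> O D.
  by move=> ->; rewrite mul1r mulrN1 => /dvrN; rewrite opprK.
move: h1; rewrite !inE => /or4P[] /eqP/esym e.
- by have := n01 0 1; rewrite mx2C; apply: (fin _ e).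
- by have := n10 0 1; rewrite mx2C; apply: (finN _ e).
- by have := n01 1 0; rewrite mx2C; apply: (finN _ e).
- by have := n10 1 0; rewrite mx2C; apply: (fin _ e).
Qed.

(** An inclusion already makes [h * g^-1] conjugate integral matrices to integral ones, so
    [normalizer_intM] applies to it. *)
Lemma conj_order_eq g h : g \in unitmx -> h \in unitmx ->
  (forall x, conj_order g x -> conj_order h x) ->
  exists2 k, k != 0 & intGL (k *: (h * g^-1)).
Proof.
move=> ug uh sub; apply: normalizer_intM => [|x ix].
  by rewrite unitmx_mul uh unitmx_inv.
have := sub (g^-1 * x * g); rewrite /conj_order => sub1.
rewrite invrM ?unitrV // invrK.
have -> : h * g^-1 * x * (g * h^-1) = h * (g^-1 * x * g) * h^-1 by rewrite !mulrA.
apply: sub1; have -> : g * (g^-1 * x * g) * g^-1 = x; last by [].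
by rewrite !mulrA mulrV // mul1r mulrK.
Qed.

Lemma intM_gens : forall x, x \in [:: mx2 1 0 0 0; mx2 0 1 0 0; mx2 0 0 1 0; mx2 0 0 0 1] ->
  intM x.
Proof.
have O0 := dvr0; have O1 := dvr1 dvrO => x.
by rewrite !inE => /or4P[] /eqP->; apply: intM_mx2.
Qed.

Lemma conj_order_of_intGL e g h x : e != 0 -> g \in unitmx -> h \in unitmx ->
  intGL (e *: (g * h^-1)) -> conj_order h x <-> conj_order g x.
Proof.
move=> e0 ug uh GL; rewrite -(conj_order_GL x uh GL) -scalerAl mulrVK //.
exact: conj_order_scale.
Qed.

Lemma is_order_intM : is_order intM.
Proof.
have O0 := dvr0; have O1 := dvr1 dvrO.
split.
- split; first by rewrite mx2_1; apply: intM_mx2.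
    by move=> x y ix iy i j; rewrite !mxE; apply: (dvrB dvrO).
  exact: intMM.
- by move=> a x Oa ix i j; rewrite mxE; apply: (dvrM dvrO).
- exists [:: mx2 1 0 0 0; mx2 0 1 0 0; mx2 0 0 1 0; mx2 0 0 0 1].
  split=> [|x ix]; first exact: intM_gens.
  exists (fun i : 'I_4 => nth 0 (entries x) i); split.
    by case=> [[|[|[|[|//]]]] lt_i] /=; apply: ix.
  rewrite {1}(mx2_eta x) /= !big_ord_recl big_ord0 /=.
  apply: eq_mx2; rewrite !mx2C !mxE /=; ring.
- move=> m; have [n0 N0] := dvr_bound dvrO (m 0 0).
  have [n1 N1] := dvr_bound dvrO (m 0 1).
  have [n2 N2] := dvr_bound dvrO (m 1 0).
  have [n3 N3] := dvr_bound dvrO (m 1 1).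
  exists (pi ^+ (n0 + n1 + n2 + n3)); split.
    by rewrite expf_neq0 // (unif_neq0 dvrO).
  have piX n : O (pi ^+ n) by apply/dvrX/(dvr_unif dvrO).
  have OX a n (k : nat) : O (a * pi ^+ n) -> (n <= k)%N -> O (pi ^+ k * a).
    by move=> Oan /subnKC <-; rewrite exprD mulrC mulrA; apply: (dvrM dvrO).
  by rewrite (mx2_eta m) mx2Z; apply: intM_mx2; [apply: OX N0 _ | apply: OX N1 _ |
    apply: OX N2 _ | apply: OX N3 _]; lia.
Qed.

Lemma order_conj S g : g \in unitmx -> is_order S ->
  is_order (fun x => S (g * x * g^-1)).
Proof.
move=> ug [[S1 SB SM] SZ [s [sS gen]] span]; split.
- split; first by rewrite mulr1 mulrV.
    by move=> x y Sx Sy; rewrite mulrBr mulrBl; apply: SB.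
  move=> x y Sx Sy.
  have -> : g * (x * y) * g^-1 = (g * x * g^-1) * (g * y * g^-1); last exact: SM.
  by rewrite !mulrA mulrVK.
- by move=> a x Oa Sx; rewrite -scalerAr -scalerAl; apply: SZ.
- exists (map (fun x => g^-1 * x * g) s); split.
    move=> _ /mapP[x xs ->]; have -> : g * (g^-1 * x * g) * g^-1 = x; last exact: sS.
    by rewrite !mulrA mulrV // mul1r mulrK.
  move=> x /gen[c [Oc e]]; move: c Oc e; rewrite -(size_map (fun x => g^-1 * x * g)).
  move=> c Oc e; exists c; split=> //.
  have -> : x = g^-1 * (g * x * g^-1) * g by rewrite !mulrA mulVr // mul1r mulrVK.
  rewrite e mulr_sumr mulr_suml; apply: eq_bigr => i _.
  rewrite -scalerAr -scalerAl; congr (_ *: _).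
  by rewrite (nth_map 0) //; have := ltn_ord i; rewrite {2}size_map.
- move=> m; have [a [a0 Sa]] := span (g * m * g^-1).
  by exists a; split=> //; rewrite -scalerAr -scalerAl.
Qed.

(* A finitely generated module has bounded denominators, whereas a ring which
   contains [intM] and a non-integral entry [f] contains all [f ^+ n E_00]. *)
Lemma intM_maximal T : is_order T -> (forall x, intM x -> T x) ->
  forall x, T x -> intM x.
Proof.
have O0 := dvr0; have O1 := dvr1 dvrO.
move=> [[T1 TB TM] TZ [s [sT gen]] _] sub x Tx i j.
set f := x i j.
have [n Nn] : exists n, forall y, T y -> O (y 0 0 * pi ^+ n).
  have [n Nn] : exists n, forall y, y \in s -> O (y 0 0 * pi ^+ n).
    elim: (s) => [|y t [n IH]]; first by exists 0.
    have [m Om] := dvr_bound dvrO (y 0 0); exists (m + n)%N => z.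
    rewrite exprD inE => /predU1P[->|/IH Oz]; rewrite ?mulrA.
      by apply: (dvrM dvrO) => //; apply/dvrX/(dvr_unif dvrO).
    rewrite mulrAC; apply: (dvrM dvrO) => //; apply/dvrX/(dvr_unif dvrO).
  exists n => y /gen[c [Oc ->]]; rewrite summxE mulr_suml; apply: dvr_sum => k.
  by rewrite mxE -mulrA; apply: (dvrM dvrO) => //; apply/Nn/mem_nth.
have Tf m : T (mx2 (f ^+ m) 0 0 0).
  elim: m => [|m IH]; first by rewrite expr0; apply/sub/intM_mx2.
  have -> : mx2 (f ^+ m.+1) 0 0 0 = mx2 f 0 0 0 * mx2 (f ^+ m) 0 0 0.
    by rewrite mx2M exprS !mulr0 !mul0r !addr0.
  apply: (TM) => //; rewrite /f; move: i j {f IH}.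
  apply: ord2P; apply: ord2P.
  - have -> : mx2 (x 0 0) 0 0 0 = mx2 1 0 0 0 * x * mx2 1 0 0 0.
      by rewrite {2}(mx2_eta x) !mx2M; congr mx2; ring.
    by apply: (TM); [apply: (TM)|] => //; apply/sub/intM_mx2.
  - have -> : mx2 (x 0 1) 0 0 0 = mx2 1 0 0 0 * x * mx2 0 0 1 0.
      by rewrite {2}(mx2_eta x) !mx2M; congr mx2; ring.
    by apply: (TM); [apply: (TM)|] => //; apply/sub/intM_mx2.
  - have -> : mx2 (x 1 0) 0 0 0 = mx2 0 1 0 0 * x * mx2 1 0 0 0.
      by rewrite {2}(mx2_eta x) !mx2M; congr mx2; ring.
    by apply: (TM); [apply: (TM)|] => //; apply/sub/intM_mx2.
  - have -> : mx2 (x 1 1) 0 0 0 = mx2 0 1 0 0 * x * mx2 0 0 1 0.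
      by rewrite {2}(mx2_eta x) !mx2M; congr mx2; ring.
    by apply: (TM); [apply: (TM)|] => //; apply/sub/intM_mx2.
have [//|Ofv] := dvr_total dvrO f.
have [f0|f0] := eqVneq f 0; first by rewrite f0.
apply: NNPP => nOf; apply: (dvr_unifV dvrO).
have Ou : O (f^-1 / pi).
  by apply: NNPP => /(dvr_div_unif dvrO Ofv); rewrite invrK.
have := Nn _ (Tf n.+1); rewrite mx2C => Ofn.
have p0 := unif_neq0 dvrO.
(* If [f] is not integral, [f^-1] is [pi] times an integral element. The bound on the denominator of
   [f ^+ n.+1] is then short by one factor [pi]. *)
have -> : pi^-1 = f ^+ n.+1 * pi ^+ n * (f^-1 / pi) ^+ n.+1.
  rewrite exprMn mulrACA -exprMn divff // expr1n mul1r exprS exprVn.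
  by rewrite mulrCA divff ?expf_neq0 ?mulr1.
by apply: (dvrM dvrO) => //; apply: dvrX.
Qed.

Lemma conj_order_order g : g \in unitmx -> is_order (conj_order g).
Proof. by move=> ug; apply: order_conj ug is_order_intM. Qed.

Lemma conj_order_maximal g T : g \in unitmx -> is_order T ->
  (forall x, conj_order g x -> T x) -> forall x, T x <-> conj_order g x.
Proof.
move=> ug oT sub x; split=> [Tx|/sub//].
have ugV : g^-1 \in unitmx by rewrite unitmx_inv.
apply: (intM_maximal (order_conj ugV oT)) => [y iy|]; rewrite invrK.
  apply: sub; rewrite /conj_order; move: iy; congr intM.
  by rewrite !mulrA mulrV // mul1r mulrK.
by move: Tx; congr T; rewrite !mulrA mulVr // mul1r mulrVK.
Qed.

End Dvr.

(** * Neighbors in the tree *)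

Section Neighbors.
Variables (F : fieldType) (O : F -> Prop) (pi : F).
Hypothesis dvrO : is_dvr O pi.
Variables (L : Type) (rep : L -> F).
Hypothesis rep_int : forall l, O (rep l).
Hypothesis rep_surj : forall f, O f -> exists l, O ((f - rep l) / pi).
Hypothesis rep_inj : forall l l', O ((rep l - rep l') / pi) -> l = l'.
Implicit Types (a g x : 'M[F]_2).

(** Up to the scalar [pi], [Some l] gives the sublattice [u + l v = 0] modulo [pi] of [O^2], and
    [None] the sublattice [v = 0]. *)
Definition nbr_mx (o : option L) : 'M[F]_2 :=
  if o is Some l then mx2 1 (rep l) 0 pi else mx2 pi 0 0 1.

Lemma nbr_mx_unit o : nbr_mx o \in unitmx.
Proof.
by case: o => [l|]; rewrite unitmx2 !(mulr1, mul1r, mulr0, mul0r) subr0 (unif_neq0 dvrO).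
Qed.

Lemma nbr_mxV o : (nbr_mx o)^-1 =
  if o is Some l then mx2 1 (- rep l / pi) 0 pi^-1 else mx2 pi^-1 0 0 1.
Proof.
have p0 := unif_neq0 dvrO.
case: o => [l|] /=.
  have [|_ ->] := @mx2V _ 1 (rep l) 0 pi; first by rewrite mulr0 mul1r subr0.
  by rewrite mx2Z; congr mx2; field.
have [|_ ->] := @mx2V _ pi 0 0 1; first by rewrite mulr0 mulr1 subr0.
by rewrite mx2Z; congr mx2; field.
Qed.

Lemma conj_order_diag (n : nat) x : conj_order O (mx2 (pi ^+ n) 0 0 1) x <->
  [/\ O (x 0 0), O (x 0 1 * pi ^+ n), O (x 1 0 / pi ^+ n) & O (x 1 1)].
Proof.
have p0 : pi ^+ n != 0 by rewrite expf_neq0 // (unif_neq0 dvrO).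
have [|_ V] := @mx2V _ (pi ^+ n) 0 0 1; first by rewrite mulr0 mulr1 subr0.
rewrite /conj_order V mx2Z {1}(mx2_eta x) !mx2M.
rewrite (_ : mx2 _ _ _ _ =
    mx2 (x 0 0) (x 0 1 * pi ^+ n) (x 1 0 / pi ^+ n) (x 1 1)).
  split=> [ix|[]]; last exact: intM_mx2.
  by split; [have := ix 0 0 | have := ix 0 1 | have := ix 1 0 | have := ix 1 1];
    rewrite mx2C.
by congr mx2; field.
Qed.

Lemma int_det a : intM O a -> O (a 0 0 * a 1 1 - a 0 1 * a 1 0).
Proof. by move=> ia; apply: (dvrB dvrO); apply: (dvrM dvrO). Qed.

Lemma intGL_det a : intGL O a ->
  a 0 0 * a 1 1 - a 0 1 * a 1 0 != 0 /\ O (a 0 0 * a 1 1 - a 0 1 * a 1 0)^-1.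
Proof.
case=> ua ia iva.
have det0 : a 0 0 * a 1 1 - a 0 1 * a 1 0 != 0 by rewrite -unitmx2 -mx2_eta.
split=> //; have [_] := mx2V det0; rewrite -mx2_eta mx2Z => V.
have := int_det iva; rewrite V !mx2C.
set D := _ - _ in det0 *; congr O; rewrite -[RHS]mul1r -(divff det0) /D; field.
exact: det0.
Qed.

Lemma dvr_unitP f : f != 0 -> O f -> O f^-1 \/ O (f / pi).
Proof.
move=> f0 Of; have [|nO] := classic (O (f / pi)); first by right.
by left; apply: (dvr_div_unif dvrO).
Qed.

(* Only the bottom row of [g] modulo [pi] matters: it is a point of the
   projective line over the residue field, and [rep] lists its affine part. *)
Lemma nbr_mx_surj a g : a \in unitmx -> g \in unitmx ->
  (forall x, conj_order O a x -> conj_order O g x) ->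
  exists o, forall x,
    conj_order O (mx2 pi 0 0 1 * g) x <-> conj_order O (nbr_mx o * a) x.
Proof.
move=> ua ug sub; have p0 := unif_neq0 dvrO.
have [k k0 GLk] := conj_order_eq dvrO ua ug sub.
set r := k *: (g * a^-1) in GLk.
have gE : g = k^-1 *: (r * a).
  by rewrite /r -scalerAl scalerA mulVf // scale1r mulrVK.
have [ur ir _] := GLk; rewrite /intM in ir; have [det0 Odet] := intGL_det GLk.
suff [o GLo] : exists o, intGL O (mx2 pi 0 0 1 * r * (nbr_mx o)^-1).
  exists o => x; have uo := nbr_mx_unit o.
  have um : nbr_mx o * a \in unitmx by rewrite unitmx_mul uo.
  rewrite -(conj_order_GL dvrO x um GLo) mulrA mulrVK // gE -scalerAr mulrA.
  apply: conj_order_scale; first by rewrite invr_eq0.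
  by rewrite !unitmx_mul ur ua (nbr_mx_unit None).
have [[r0 Or]|nr] := classic (r 1 0 != 0 /\ O (r 1 0)^-1).
  have [l Ol] := rep_surj (dvrM dvrO (ir 1 1) Or); exists (Some l).
  rewrite nbr_mxV {1}(mx2_eta r) !mx2M.
  rewrite (_ : mx2 _ _ _ _ = mx2 (pi * r 0 0) (r 0 1 - r 0 0 * rep l)
     (r 1 0) (r 1 0 * ((r 1 1 / r 1 0 - rep l) / pi))); last first.
    by congr mx2; field; rewrite ?r0 ?p0.
  have e : pi * r 0 0 * (r 1 0 * ((r 1 1 / r 1 0 - rep l) / pi)) -
    (r 0 1 - r 0 0 * rep l) * r 1 0 = r 0 0 * r 1 1 - r 0 1 * r 1 0.
    by field; rewrite ?r0 ?p0.
  apply: (intGL_mx2 dvrO); rewrite ?e //.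
  - by apply: (dvrM dvrO) => //; apply: (dvr_unif dvrO).
  - by apply: (dvrB dvrO) => //; apply: (dvrM dvrO).
  - by apply: (dvrM dvrO).
have Or : O (r 1 0 / pi).
  have [->|r0] := eqVneq (r 1 0) 0; first by rewrite mul0r; apply: dvr0 dvrO.
  by have [Or|//] := dvr_unitP r0 (ir 1 0); case: nr.
exists None; rewrite nbr_mxV {1}(mx2_eta r) !mx2M.
rewrite (_ : mx2 _ _ _ _ = mx2 (r 0 0) (pi * r 0 1) (r 1 0 / pi) (r 1 1)); last first.
  by congr mx2; field.
have e : r 0 0 * r 1 1 - pi * r 0 1 * (r 1 0 / pi) = r 0 0 * r 1 1 - r 0 1 * r 1 0.
  by field.
apply: (intGL_mx2 dvrO); rewrite ?e //.
by apply: (dvrM dvrO) => //; apply: (dvr_unif dvrO).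
Qed.

(** [mx2 0 1 1 (rep l)] lies in [GL_2(O)] and moves the affine point [l] to infinity, so every
    neighbor is the diagonal one in a suitable basis. *)
Lemma nbr_mx_adj o a : a \in unitmx -> exists g, [/\ g \in unitmx,
  (forall x, conj_order O a x <-> conj_order O g x) &
  forall x, conj_order O (nbr_mx o * a) x <-> conj_order O (mx2 pi 0 0 1 * g) x].
Proof.
move=> ua; case: o => [l|]; last by exists a.
have O0 := dvr0 dvrO; have O1 := dvr1 dvrO.
have GLs : intGL O (mx2 0 1 1 0).
  by apply: (intGL_mx2 dvrO); rewrite ?mulr0 ?mulr1 ?sub0r ?oppr_eq0 ?oner_neq0 ?invrN1 //;
     apply: (dvrN dvrO).
have GLl : intGL O (mx2 0 1 1 (rep l)).
  by apply: (intGL_mx2 dvrO); rewrite ?mul0r ?mulr1 ?sub0r ?oppr_eq0 ?oner_neq0 ?invrN1 //;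
     apply: (dvrN dvrO).
have [ul _ _] := GLl.
exists (mx2 0 1 1 (rep l) * a); split=> [|x|x].
- by rewrite unitmx_mul ul.
- by rewrite (conj_order_GL dvrO).
- have -> : mx2 pi 0 0 1 * (mx2 0 1 1 (rep l) * a) =
    mx2 0 1 1 0 * (nbr_mx (Some l) * a).
    by rewrite !mulrA /= !mx2M; congr (mx2 _ _ _ _ * a); ring.
  have um : nbr_mx (Some l) * a \in unitmx by rewrite unitmx_mul nbr_mx_unit.
  by rewrite (conj_order_GL dvrO x um GLs).
Qed.

(** The determinant of [k *: m] is [k ^+ 2], which is therefore a unit, and totality passes this on
    to [k]. *)
Lemma scale_unit k (m : 'M[F]_2) : k != 0 -> intGL O (k *: m) ->
  m 0 0 * m 1 1 - m 0 1 * m 1 0 = 1 -> O k /\ O k^-1.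
Proof.
move=> k0 GL e; have [_ iM _] := GL; have [_] := intGL_det GL.
have := int_det iM; rewrite !mxE.
rewrite (_ : _ - _ = k ^+ 2 * (m 0 0 * m 1 1 - m 0 1 * m 1 0)); last by ring.
rewrite e mulr1 => Ok2 Ok2V.
by have [Ok|OkV] := dvr_total dvrO k; split=> //;
  [rewrite (_ : k^-1 = (k ^+ 2)^-1 * k) | rewrite (_ : k = k ^+ 2 * k^-1)];
  by [apply: (dvrM dvrO) | field].
Qed.

(** The quotient of two neighbor matrices has determinant one. By [scale_unit] the scalar from
    [conj_order_eq] is a unit, so the quotient itself is integral. One of its entries is then
    [(rep l' - rep l) / pi] or, if exactly one point is at infinity, [pi^-1]. *)
Lemma nbr_mx_inj o o' a : a \in unitmx ->
  (forall x, conj_order O (nbr_mx o * a) x -> conj_order O (nbr_mx o' * a) x) ->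
  o = o'.
Proof.
move=> ua sub; have p0 := unif_neq0 dvrO.
have u := nbr_mx_unit.
have um : forall o, nbr_mx o * a \in unitmx by move=> q; rewrite unitmx_mul u.
have [k k0] := conj_order_eq dvrO (um o) (um o') sub.
rewrite invrM // mulrA mulrK //.
have key (m : 'M[F]_2) : intGL O (k *: m) ->
    m 0 0 * m 1 1 - m 0 1 * m 1 0 = 1 -> intM O m.
  move=> GL /(scale_unit k0 GL) [Ok OkV] i j.
  have [_ iM _] := GL; have := dvrM dvrO OkV (iM i j).
  by rewrite mxE mulKf.
move=> /key; rewrite nbr_mxV; case: o {sub} => [l|]; case: o' => [l'|] //=;
  rewrite mx2M !mx2C => key1.
- congr Some; apply/esym/rep_inj.
  have /key1/(_ 0 1) : (1 * 1 + rep l' * 0) * (0 * (- rep l / pi) + pi / pi) -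
    (1 * (- rep l / pi) + rep l' / pi) * (0 * 1 + pi * 0) = 1 by field.
  by rewrite mx2C; congr O; field.
- have /key1/(_ 1 1) : (pi * 1 + 0 * 0) * (0 * (- rep l / pi) + 1 / pi) -
     (pi * (- rep l / pi) + 0 / pi) * (0 * 1 + 1 * 0) = 1 by field.
  by rewrite mx2C mul0r add0r mul1r => /(dvr_unifV dvrO).
- have /key1/(_ 0 0) : (1 / pi + rep l' * 0) * (0 * 0 + pi * 1) -
    (1 * 0 + rep l' * 1) * (0 / pi + pi * 0) = 1 by field.
  by rewrite mx2C mulr0 addr0 mul1r => /(dvr_unifV dvrO).
Qed.

End Neighbors.

(** * The places of the rational function field *)

Lemma dvdp_factor (k : fieldType) (q a : {poly k}) :
  q %| a -> exists c : {poly k}, a = c * q.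
Proof. by case/dvdpP => c ->; exists c. Qed.

(* [size_mul] reaches the ring structure through [idomainType], so [lia] would
   take its [size] for a different term; the same holds for [dvdp_leq]. *)
Lemma size_polyM (k : fieldType) (a b : {poly k}) : a != 0 -> b != 0 ->
  size (a * b) = (size a + size b).-1.
Proof. exact: size_mul. Qed.

Lemma size_polyM_leq (k : fieldType) (a b : {poly k}) m n :
  (size a <= m)%N -> (size b <= n)%N -> (size (a * b)%R <= (m + n).-1)%N.
Proof.
move=> am bn; apply: leq_trans (size_polyMleq _ _) _.
by rewrite -!subn1 leq_sub2r // leq_add.
Qed.

Lemma dvdp_size_leq (k : fieldType) (a b : {poly k}) :
  b != 0 -> a %| b -> (size a <= size b)%N.
Proof. exact: dvdp_leq. Qed.

Lemma irreducible_coprime (k : fieldType) (q b : {poly k}) :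
  irreducible_poly q -> ~~ (q %| b) -> coprimep q b.
Proof.
move=> [q1 irr] nqb; have [//|nco] := boolP (coprimep q b).
case/negP: nqb; have /irr : size (gcdp q b) != 1 by [].
by move=> /(_ (dvdp_gcdl _ _)) /eqp_dvdl <-; apply: dvdp_gcdr.
Qed.

Lemma irreducible_dvdM (k : fieldType) (q a b : {poly k}) :
  irreducible_poly q -> (q %| a * b) = (q %| a) || (q %| b).
Proof.
move=> irr; have [qa|nqa] /= := boolP (q %| a); first by rewrite dvdp_mulr.
by rewrite Gauss_dvdpr // irreducible_coprime.
Qed.

Lemma split_power (k : fieldType) (q b : {poly k}) : (1 < size q)%N -> b != 0 ->
  exists n (c : {poly k}), b = c * q ^+ n /\ ~~ (q %| c).
Proof.
move=> q1; have q0 : q != 0 by rewrite -size_poly_gt0 ltnW.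
have [n] := ubnP (size b); elim: n b => // n IH b sb b0.
have [/dvdp_factor[c bE]|nqb] := boolP (q %| b); last by exists 0, b; rewrite expr0 mulr1.
have c0 : c != 0 by apply: contraNneq b0 => c0; rewrite bE c0 mul0r.
have [||m [e [cE nqe]]] := IH c; last first.
- by exists m.+1, e; split=> //; rewrite exprSr mulrA -cE.
- exact: c0.
- move: sb; rewrite bE size_polyM //; have : (0 < size c)%N by rewrite size_poly_gt0.
  lia.
Qed.

Section RatFun.
Variables (k F : fieldType) (t : {rmorphism {poly k} -> F}).
Hypothesis t_eq0 : forall a, (t a == 0) = (a == 0).
Hypothesis t_frac : forall f, exists (a b : {poly k}), b != 0 /\ f = t a / t b.
Implicit Types (a b q : {poly k}) (f : F).

Definition finO q f := exists (a b : {poly k}), b != 0 /\ ~~ (q %| b) /\ f = t a / t b.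
Definition infO f := exists (a b : {poly k}), b != 0 /\ (size a <= size b)%N /\ f = t a / t b.

Let t_neq0 a : a != 0 -> t a != 0. Proof. by rewrite t_eq0. Qed.

Lemma t_inj a b : t a = t b -> a = b.
Proof. by move/eqP; rewrite -subr_eq0 -rmorphB t_eq0 subr_eq0 => /eqP. Qed.

Lemma t_cross a b c d : b != 0 -> d != 0 -> t a / t b = t c / t d -> a * d = c * b.
Proof.
move=> b0 d0 e; apply: t_inj; rewrite !rmorphM /=.
have -> : t a * t d = t a / t b * t b * t d by field; apply: t_neq0.
by rewrite e; field; apply: t_neq0.
Qed.

Lemma fracB a b c d : b != 0 -> d != 0 ->
  t a / t b - t c / t d = t (a * d - c * b) / t (b * d).
Proof. by move=> b0 d0; rewrite rmorphB !rmorphM /=; field; rewrite !t_neq0. Qed.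

Lemma fracM a b c d : b != 0 -> d != 0 ->
  (t a / t b) * (t c / t d) = t (a * c) / t (b * d).
Proof. by move=> b0 d0; rewrite !rmorphM /=; field; rewrite !t_neq0. Qed.

Lemma finO_poly q a : irreducible_poly q -> finO q (t a).
Proof.
move=> [q1 _]; exists a, 1; rewrite oner_neq0 rmorph1 divr1 dvdp1; split=> //.
by split=> //; rewrite gtn_eqF.
Qed.

Lemma finO_invP q a : irreducible_poly q -> a != 0 -> finO q (t a)^-1 <-> ~~ (q %| a).
Proof.
move=> irr a0; split=> [[c [b [b0 [nqb e]]]]|nqa].
  have := @t_cross 1 a c b a0 b0; rewrite rmorph1 mul1r => /(_ e) bE.
  by apply: contra nqb => qa; rewrite -[b]mul1r bE dvdp_mull.
by exists 1, a; rewrite rmorph1 mul1r.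
Qed.

Lemma finO_dvr q : irreducible_poly q -> is_dvr (finO q) (t q).
Proof.
move=> irr; have q0 := irredp_neq0 irr; have [q1 _] := irr; split.
- by rewrite -(rmorph1 t); apply: finO_poly.
- move=> _ _ [a [b [b0 [nqb ->]]]] [c [d [d0 [nqd ->]]]]; rewrite fracB //.
  exists (a * d - c * b), (b * d); rewrite mulf_neq0 //; split=> //; split=> //.
  by rewrite irreducible_dvdM // negb_or nqb.
- move=> _ _ [a [b [b0 [nqb ->]]]] [c [d [d0 [nqd ->]]]]; rewrite fracM //.
  exists (a * c), (b * d); rewrite mulf_neq0 //; split=> //; split=> //.
  by rewrite irreducible_dvdM // negb_or nqb.
- move=> f; have [a [b [b0 ->]]] := t_frac f.
  have [->|a0] := eqVneq a 0.
    by left; rewrite rmorph0 mul0r -(rmorph0 t); apply: finO_poly.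
  have [n [c [aE nqc]]] := split_power q1 a0.
  have [m [d [bE nqd]]] := split_power q1 b0.
  have c0 : c != 0 by apply: contraNneq a0 => c0; rewrite aE c0 mul0r.
  have d0 : d != 0 by apply: contraNneq b0 => d0; rewrite bE d0 mul0r.
  have tq := t_neq0 q0; have [mn|/ltnW nm] := leqP m n.
    left; exists (c * q ^+ (n - m)), d; split=> //; split=> //.
    rewrite aE bE -{1}(subnK mn) exprD !rmorphM /= !rmorphXn /=; field.
    by rewrite t_neq0 // expf_neq0.
  right; exists (d * q ^+ (m - n)), c; split=> //; split=> //.
  rewrite aE bE -{1}(subnK nm) exprD !rmorphM /= !rmorphXn /=; field.
  by rewrite !t_neq0 //= !expf_neq0.
- exact: t_neq0.
- exact: finO_poly.
- by rewrite finO_invP // dvdpp.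
- move=> _ [a [b [b0 [nqb ->]]]] nO.
  have [/dvdp_factor[c aE]|nqa] := boolP (q %| a).
    case: nO; exists c, b; split=> //; split=> //.
    by rewrite aE rmorphM /=; field; rewrite !t_neq0.
  have a0 : a != 0 by apply: contraNneq nqa => ->; apply: dvdp0.
  by exists b, a; split=> //; split=> //; rewrite invf_div.
- move=> f; have [a [b [b0 ->]]] := t_frac f.
  have [m [d [bE nqd]]] := split_power q1 b0; exists m.
  have d0 : d != 0 by apply: contraNneq b0 => d0; rewrite bE d0 mul0r.
  exists a, d; split=> //; split=> //.
  by rewrite bE rmorphM rmorphXn /=; field; rewrite expf_neq0 ?t_neq0.
Qed.

Lemma infO_poly_div a b : b != 0 -> infO (t a / t b) <-> (size a <= size b)%N.
Proof.
move=> b0; split=> [[c [d [d0 [scd e]]]]|]; last by exists a, b.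
have := t_cross b0 d0 e => E.
have [->|a0] := eqVneq a 0; first by rewrite size_poly0.
have c0 : c != 0.
  by apply/eqP => c0; move/eqP: E; rewrite c0 mul0r mulf_eq0 (negPf a0) (negPf d0).
have := congr1 (fun r : {poly k} => size r) E; rewrite !size_polyM //.
move: a0 b0 c0 d0; rewrite -!size_poly_gt0; lia.
Qed.

Lemma infO_dvr : is_dvr infO (t 'X)^-1.
Proof.
have X0 : 'X != 0 :> {poly k} by rewrite polyX_eq0.
split.
- by exists 1, 1; rewrite oner_neq0 rmorph1 divr1.
- move=> _ _ [a [b [b0 [sb ->]]]] [c [d [d0 [sd ->]]]]; rewrite fracB //.
  apply/infO_poly_div; rewrite ?mulf_neq0 //.
  apply: leq_trans (size_polyD _ _) _; rewrite size_polyN geq_max.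
  by rewrite (size_polyM b0 d0) // size_polyM_leq //= addnC size_polyM_leq.
- move=> _ _ [a [b [b0 [sb ->]]]] [c [d [d0 [sd ->]]]]; rewrite fracM //.
  apply/infO_poly_div; rewrite ?mulf_neq0 //.
  by rewrite [X in (_ <= X)%N]size_polyM // size_polyM_leq.
- move=> f; have [a [b [b0 ->]]] := t_frac f.
  have [->|a0] := eqVneq a 0.
    by left; apply/infO_poly_div; rewrite ?size_poly0.
  by rewrite invf_div !infO_poly_div //; apply/orP/leq_total.
- by rewrite invr_eq0 t_neq0.
- by rewrite -[_^-1]mul1r -(rmorph1 t); apply/infO_poly_div; rewrite ?size_poly1 ?size_polyX.
- rewrite invrK -[t 'X]divr1 -(rmorph1 t) infO_poly_div ?oner_neq0 //.
  by rewrite size_poly1 size_polyX.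
- move=> _ [a [b [b0 [sb ->]]]]; rewrite invrK.
  rewrite -[X in infO (_ * X)]divr1 -(rmorph1 t) fracM ?oner_neq0 // mulr1.
  rewrite infO_poly_div // => nsz; rewrite invf_div.
  have a0 : a != 0 by apply/eqP => a0; case: nsz; rewrite a0 mul0r size_poly0.
  move: nsz; rewrite size_mulX // => nsz; apply/infO_poly_div => //; lia.
- move=> f; have [a [b [b0 ->]]] := t_frac f; exists (size a).
  rewrite exprVn -rmorphXn /= -mulrA -invfM -rmorphM.
  apply/infO_poly_div; rewrite ?mulf_neq0 ?expf_neq0 // size_mulXn //.
  exact: leq_addr.
Qed.

Lemma finO_rep_surj q f : irreducible_poly q -> finO q f ->
  exists l : {poly k}, (size l <= (size q).-1)%N /\ finO q ((f - t l) / t q).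
Proof.
move=> irr [a [b [b0 [nqb ->]]]]; have q0 := irredp_neq0 irr.
have /Bezout_eq1_coprimepP[[u v] /= uv] := irreducible_coprime irr nqb.
(* The Bezout coefficient [v] inverts [b] modulo [q]. *)
exists ((a * v) %% q); split.
  by have := ltn_modpN0 (a * v) q0; case: (size q).
have : q %| a - ((a * v) %% q) * b.
  have e := divp_eq (a * v) q; set r := _ %% q in e *; set w := _ %/ q in e.
  have -> : a - r * b = (w * b + a * u) * q.
    have -> : r = a * v - w * q by rewrite e addrC addKr.
    by rewrite -{1}[a]mulr1 -uv; ring.
  exact: dvdp_mulIr.
case/dvdp_factor => c e; exists c, b; split=> //; split=> //.
have /(congr1 t) := e; rewrite rmorphB !rmorphM /= => et.
have -> : t c = (t a - t ((a * v) %% q) * t b) / t q by rewrite et; field; rewrite t_neq0.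
by field; rewrite !t_neq0.
Qed.

Lemma finO_rep_inj q (l : {poly k}) : irreducible_poly q ->
  (size l <= (size q).-1)%N -> finO q (t l / t q) -> l = 0.
Proof.
move=> irr sl [a [b [b0 [nqb e]]]]; have q0 := irredp_neq0 irr.
have /eqP := t_cross q0 b0 e => /eqP E.
have : q %| l * b by rewrite E dvdp_mull.
rewrite irreducible_dvdM // (negPf nqb) orbF => ql; apply/eqP.
apply: contraTT ql => l0; apply/negP => /(dvdp_size_leq l0) qsz.
by have q1 : (1 < size q)%N by [case: irr]; move: (leq_trans qsz sl); lia.
Qed.

Lemma infO_rep_surj f : infO f ->
  exists l : {poly k}, (size l <= 1)%N /\ infO ((f - t l) / (t 'X)^-1).
Proof.
move=> [a [b [b0 [sab ->]]]].
have [l [sl sz]] : exists l : {poly k}, (size l <= 1)%N /\ (size (a - l * b)%R < size b)%N.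
  (* This coefficient of [a] is the leading one only if [a] and [b] have the same degree; otherwise
     it is [0], which is then the residue. *)
  exists (a`_(size b).-1 / lead_coef b)%:P; split; first by apply: size_polyC_leq1.
  have sb : (0 < size b)%N by rewrite size_poly_gt0.
  rewrite -[X in (_ < X)%N](prednK sb) ltnS; apply/leq_sizeP => j.
  rewrite leq_eqVlt coefB coefCM => /predU1P[<-|lt_j].
    by rewrite -lead_coefE divfK ?subrr // lead_coef_eq0.
  have bj : (size b <= j)%N by lia.
  by rewrite (nth_default 0 bj) (nth_default 0 (leq_trans sab bj)) mulr0 subr0.
exists l; split=> //; have X0 : 'X != 0 :> {poly k} by rewrite polyX_eq0.
have -> : (t a / t b - t l) / (t 'X)^-1 = t ((a - l * b) * 'X) / t b.
  by rewrite invrK rmorphM rmorphB rmorphM /=; field; rewrite t_neq0.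
apply/infO_poly_div => //; have [->|n0] := eqVneq (a - l * b) 0.
  by rewrite mul0r size_poly0.
by rewrite size_mulX.
Qed.

Lemma infO_rep_inj (l : {poly k}) : (size l <= 1)%N -> infO (t l / (t 'X)^-1) -> l = 0.
Proof.
move=> sl; rewrite invrK -rmorphM -[t _]divr1 -(rmorph1 t) infO_poly_div ?oner_neq0 //.
apply: contraTeq => l0; rewrite size_mulX // size_poly1 -ltnNge ltnS size_poly_gt0 //.
Qed.

End RatFun.

(** * Families of local orders *)

Lemma mul_exprzN0 (F : fieldType) (f u : F) : f * u ^ (- (0 : int)) = f.
Proof. by rewrite oppr0 expr0z mulr1. Qed.

Lemma mul_exprzNN (F : fieldType) (f u : F) (n : nat) :
  f * u ^ (- (- n%:Z)) = f * u ^+ n.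
Proof. by rewrite opprK. Qed.

Lemma mul_exprzN (F : fieldType) (f u : F) (n : nat) : f * u ^ (- n%:Z) = f / u ^+ n.
Proof. by rewrite -exprnN. Qed.

Section Places.
Variable p : nat.
Implicit Types (P R : option {poly 'F_p}) (f : K p) (x g h : Mat p).

(** [tf] with its structure of ring morphism, to instantiate the abstract [t] of the lemmas
    above. *)
Definition tfm : {rmorphism {poly 'F_p} -> K p} := @FracField.tofrac {poly 'F_p}.

Lemma tfm_eq0 (a : {poly 'F_p}) : (tfm a == 0) = (a == 0).
Proof. exact: tofrac_eq0. Qed.

Lemma tfm_frac f : exists a b : {poly 'F_p}, b != 0 /\ f = tfm a / tfm b.
Proof.
elim/quotW: f => -[[a b] /= b0]; exists a, b; split=> //.
apply: (canRL (mulfK _)); first by rewrite tfm_eq0.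
rewrite /= /tfm; unlock FracField.tofrac; rewrite -[LHS]FracField.pi_mul.
by apply/eqmodP; rewrite /= FracField.equivfE /FracField.mulf /= !numden_Ratio ?mulr1 ?oner_neq0 // mulrC.
Qed.

Lemma place_dvr P : is_place P -> is_dvr (locO P) (unif P).
Proof.
case: P => [q [_ irr]|_].
  exact: (finO_dvr tfm_eq0 tfm_frac irr).
exact: (infO_dvr tfm_eq0 tfm_frac).
Qed.

(** Polynomials of degree less than [place_deg P] represent the residue field; at infinity these are
    the constants. They form a finite type, so neighbors can be counted by a cardinal. *)
Definition place_rep P (l : {poly_(place_deg P) 'F_p}) : K p := tfm (val l).

Lemma place_rep_int P l : is_place P -> locO P (@place_rep P l).
Proof.
case: P l => [q|] l /=; first by case=> _ irr; apply: (finO_poly tfm).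
move=> _; have := size_npoly l; rewrite /place_rep -[tfm _]divr1 -(rmorph1 tfm) => sl.
by apply/(infO_poly_div tfm_eq0); rewrite ?oner_neq0 // size_poly1.
Qed.

Lemma place_rep_surj P f : is_place P -> locO P f ->
  exists l, locO P ((f - @place_rep P l) / unif P).
Proof.
case: P => [q|] /=.
  move=> [_ irr] /(finO_rep_surj tfm_eq0 irr) [l [sl Ol]].
  by exists (NPoly sl).
by move=> _ /(infO_rep_surj tfm_eq0) [l [sl Ol]]; exists (NPoly sl).
Qed.

Lemma place_rep_inj P l l' : is_place P ->
  locO P ((@place_rep P l - place_rep l') / unif P) -> l = l'.
Proof.
move=> plP; rewrite /place_rep -rmorphB => Oll.
have sl : (size (val l - val l')%R <= place_deg P)%N.
  apply: leq_trans (size_polyD _ _) _; rewrite size_polyN geq_max.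
  by rewrite !size_npoly.
apply/val_inj/eqP; rewrite -subr_eq0; apply/eqP.
case: P plP l l' sl Oll => [q [_ irr]|_] l l' sl Oll.
  exact: (finO_rep_inj tfm_eq0 irr sl Oll).
exact: (infO_rep_inj tfm_eq0 sl Oll).
Qed.

Lemma M2OE P x : M2O P x <-> intM (locO P) x.
Proof.
rewrite /M2O /valmat /inpow !mul_exprzN0; split=> [[]|ix]; last by split.
by rewrite {5}(mx2_eta x) => *; apply: intM_mx2.
Qed.

Lemma valmatE P (n : nat) x : is_place P ->
  valmat P 0 (- n%:Z) n%:Z 0 x <-> conj_order (locO P) (mx2 (unif P ^+ n) 0 0 1) x.
Proof.
move=> plP.
have H := conj_order_diag (place_dvr plP) n x.
apply: iff_trans (iff_sym H).
rewrite /valmat /inpow.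
rewrite !mul_exprzN0.
rewrite mul_exprzNN.
rewrite mul_exprzN.
by [].
Qed.

Lemma tree_adjE P (S T : mset p) : is_place P -> tree_adj P S T <->
  exists g, g \in unitmx /\ mseteq S (conj_order (locO P) g) /\
    mseteq T (conj_order (locO P) (mx2 (unif P) 0 0 1 * g)).
Proof.
move=> plP; have u0 := unif_neq0 (place_dvr plP).
have ud := unitmx_diag u0.
split=> -[g [ug [eS eT]]]; exists g; split=> //; split=> x.
- by rewrite eS M2OE.
- apply: iff_trans (eT x) _; apply: iff_trans (iff_sym (conj_orderM _ _ ud ug)).
  exact: (valmatE 1).
- by rewrite eS M2OE.
- apply: iff_trans (eT x) _; apply: iff_trans (conj_orderM _ _ ud ug) _.
  exact: iff_sym (valmatE 1 _ plP).
Qed.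

Definition fam (a : option {poly 'F_p} -> Mat p) : Xfam p :=
  fun R => conj_order (locO R) (a R).

(** An element of the adelic [GL_2] in terms of stalks: the finite exceptional set is what
    [is_Xorder] asks of [fam a]. *)
Definition adelic (a : option {poly 'F_p} -> Mat p) : Prop :=
  (forall R, is_place R -> a R \in unitmx) /\
  exists s : seq (option {poly 'F_p}),
    forall R, is_place R -> R \notin s -> intGL (locO R) (a R).

Lemma fam_max a : adelic a -> is_max_Xorder (fam a).
Proof.
move=> [ua [s GLs]]; split.
  split=> [R plR|]; first exact: (conj_order_order (place_dvr plR) (ua R plR)).
  exists s => R plR Rs x; rewrite M2OE /fam.
  exact: (conj_order_intGL (place_dvr plR) x (GLs R plR Rs)).
move=> R plR; split; first exact: (conj_order_order (place_dvr plR) (ua R plR)).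
move=> T oT sub x; exact: (conj_order_maximal (place_dvr plR) (ua R plR) oT sub).
Qed.

(* [o = None] is the point at infinity of the projective line over the residue
   field of [P]. *)
Definition upd (a : option {poly 'F_p} -> Mat p) P
    (o : option {poly_(place_deg P) 'F_p}) : option {poly 'F_p} -> Mat p :=
  fun R => if R == P then nbr_mx (unif P) (@place_rep P) o * a P else a R.

Lemma upd_adelic a P o : is_place P -> adelic a -> adelic (@upd a P o).
Proof.
move=> plP [ua [s GLs]]; split=> [R plR|]; rewrite /upd.
  case: eqP => [_|_]; last exact: ua.
  by rewrite unitmx_mul (nbr_mx_unit (place_dvr plP)) ua.
exists (P :: s) => R plR; rewrite inE negb_or => /andP[/negPf-> ]; exact: GLs.
Qed.

Lemma P_neighbor_upd a P o : is_place P -> adelic a ->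
  P_neighbor P (fam a) (fam (@upd a P o)).
Proof.
move=> plP ada; split; first exact/fam_max/upd_adelic.
split=> [R plR /eqP/negPf RP x|]; first by rewrite /fam /upd RP.
apply/tree_adjE => //; have [ua _] := ada.
have [g [ug eg eo]] := nbr_mx_adj (place_dvr plP)
  (fun l => place_rep_int l plP) o (ua P plP).
exists g; split; first exact: ug.
by split=> x; [exact: eg | rewrite /fam /upd eqxx; exact: eo].
Qed.

Lemma P_neighbor_upd_surj a D P D' : is_place P -> adelic a -> Xeq D (fam a) ->
  P_neighbor P D D' -> exists o, Xeq D' (fam (@upd a P o)).
Proof.
move=> plP [ua _] eD [_ [off /(tree_adjE _ _ plP)[g [ug [eS eT]]]]].
have [|||||o eo] := @nbr_mx_surj _ _ _ (place_dvr plP) _ (@place_rep P) _ _ (a P) g.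
- by move=> l; apply: place_rep_int.
- by move=> f; apply: place_rep_surj.
- exact: ua.
- exact: ug.
- by move=> x; rewrite -eS eD.
exists o => R plR x; rewrite /fam /upd; case: eqP => [->|RP].
  by rewrite eT eo.
by rewrite off // eD.
Qed.

Lemma upd_inj a P o o' : is_place P -> adelic a ->
  Xeq (fam (@upd a P o)) (fam (upd a o')) -> o = o'.
Proof.
move=> plP [ua _] /(_ P plP) e.
apply: (nbr_mx_inj (place_dvr plP) _ (ua P plP)) => [l l'|x].
  exact: place_rep_inj.
by move: (e x); rewrite /fam /upd eqxx => -[].
Qed.

Lemma Xiso_Xeql D1 D2 D' : Xeq D1 D2 -> Xiso D1 D' -> Xiso D2 (D' : Xfam p).
Proof.
move=> e [g [ug eg]]; exists g; split=> // R plR x.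
by rewrite eg // e.
Qed.

(** By [P_neighbor_upd_surj] and [upd_inj] the points of the projective line list every neighbor
    exactly once, so the neighbors of a given class are counted by a predicate on points. *)
Lemma N_is_fam P a D D' (pr : pred (option {poly_(place_deg P) 'F_p})) :
  is_place P -> adelic a -> Xeq D (fam a) ->
  (forall o, Xiso (fam (upd a o)) D' <-> pr o) -> N_is P D D' #|pr|.
Proof.
move=> plP ada eD prP.
exists [seq fam (upd a o) | o <- enum pr]; rewrite size_map -cardE.
have nthE i (lti : (i < #|pr|)%N) : nthX [seq fam (upd a o) | o <- enum pr] i =
    fam (upd a (enum_val (Ordinal lti))).
  rewrite /nthX (nth_map None); last by rewrite -cardE.
  by rewrite (enum_val_nth None).
split=> // [i lti|i j lti ltj|D'' [nb iso]].
- rewrite nthE; split; last by apply/prP; exact: (enum_valP (Ordinal lti)).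
  have [mx [off adj]] := P_neighbor_upd (enum_val (Ordinal lti)) plP ada.
  split=> //; split=> [R plR RP x|]; first by rewrite off // eD.
  apply/tree_adjE => //; move/tree_adjE: adj => /(_ plP)[g [ug [eS eT]]].
  by exists g; split; [exact: ug|split=> [x|]; [exact: iff_trans (eD P plP x) (eS x)|exact: eT]].
- rewrite !nthE => /(upd_inj plP ada)/enum_val_inj/(congr1 val); exact.
- have [o eo] := P_neighbor_upd_surj plP ada eD nb.
  have oP : o \in pr by apply/prP/(Xiso_Xeql eo).
  exists (enum_rank_in oP o); first exact: ltn_ord.
  have lto := ltn_ord (enum_rank_in oP o); rewrite (nthE _ lto).
  suff -> : enum_val (Ordinal lto) = o by exact: eo.
  rewrite -[RHS](enum_rankK_in oP oP); congr enum_val; exact: val_inj.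
Qed.

Lemma Xiso_famE a b : (forall R, is_place R -> a R \in unitmx) ->
  Xiso (fam a) (fam b) <-> exists g, g \in unitmx /\ forall R, is_place R ->
    forall x, conj_order (locO R) (b R) x <-> conj_order (locO R) (a R * g) x.
Proof.
move=> ua; split=> -[g [ug eg]]; exists g^-1; split; try exact: unitmx_invr; move=> R plR x.
  exact: iff_trans (eg R plR x) (iff_sym (conj_orderMV _ _ (ua R plR) ug)).
exact: iff_trans (eg R plR x) (conj_orderVM _ _ (ua R plR) ug).
Qed.

End Places.

(** * Unimodular matrices over the local rings *)

Lemma irreducible_factor (k : fieldType) (b : {poly k}) : (1 < size b)%N ->
  exists q, [/\ q \is monic, irreducible_poly q & q %| b].
Proof.
have [n] := ubnP (size b); elim: n b => // n IH b sb b1.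
have b0 : b != 0 by rewrite -size_poly_gt0 ltnW.
have lb0 : lead_coef b != 0 by rewrite lead_coef_eq0.
have [irr|nirr] := classic (forall d : {poly k}, size d != 1 -> d %| b -> d %= b).
  have e : (lead_coef b)^-1 *: b %= b by rewrite eqp_scale // invr_eq0.
  exists ((lead_coef b)^-1 *: b); split; last by rewrite (eqp_dvdl _ e).
    by rewrite monicE lead_coefZ mulVf.
  split=> [|d d1]; first by rewrite (eqp_size e).
  by rewrite (eqp_dvdr _ e) (eqp_rtrans e); apply: irr.
have [d nd] := not_all_ex_not _ _ nirr.
have [d1 nd1] := imply_to_and _ _ nd; have [db ndb] := imply_to_and _ _ nd1.
have d0 : d != 0 by apply: contraTneq db => ->; rewrite dvd0p.
have sd : (size d < size b)%N.
  rewrite ltn_neqAle (dvdp_size_leq b0 db) andbT.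
  by apply: contra_notN ndb => /eqP e; rewrite -dvdp_size_eqp //; apply/eqP.
have [||q [mq iq qd]] := IH d.
- by move: sb sd; lia.
- by rewrite ltn_neqAle eq_sym d1 size_poly_gt0.
by exists q; split=> //; apply: dvdp_trans qd db.
Qed.

Section RatFunGL.
Variables (k F : fieldType) (t : {rmorphism {poly k} -> F}).
Hypothesis t_eq0 : forall a, (t a == 0) = (a == 0).
Hypothesis t_frac : forall f, exists a b, b != 0 /\ f = t a / t b.
Implicit Types (a b c d q l u v : {poly k}).

Let t_neq0 a : a != 0 -> t a != 0. Proof. by rewrite t_eq0. Qed.
Let X0 : 'X != 0 :> {poly k}. Proof. by rewrite polyX_eq0. Qed.
Let tX0 : t 'X != 0. Proof. exact: t_neq0. Qed.

(** In lowest terms, an irreducible factor of the denominator would be a place where [f] has a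
    pole. *)
Lemma finO_all_poly (f : F) :
  (forall q, q \is monic -> irreducible_poly q -> finO t q f) -> exists a, f = t a.
Proof.
move=> Of; have [a [b [b0 fE]]] := t_frac f.
set g := gcdp a b; have g0 : g != 0 by rewrite gcdp_eq0 negb_and b0 orbT.
have co : coprimep (a %/ g) (b %/ g) by rewrite coprimep_div_gcd // b0 orbT.
have aE : a = a %/ g * g by rewrite divpK // dvdp_gcdl.
have bE : b = b %/ g * g by rewrite divpK // dvdp_gcdr.
move: (a %/ g) (b %/ g) co aE bE => a1 b1 co aE bE.
have b10 : b1 != 0 by apply: contraNneq b0 => b10; rewrite bE b10 mul0r.
have {}fE : f = t a1 / t b1.
  by rewrite fE aE bE !rmorphM /=; field; rewrite !t_neq0.
have [sb|sb] := leqP (size b1) 1.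
  have e := size1_polyC sb; exists (a1 * (b1`_0)^-1%:P).
  have c0 : b1`_0 != 0 by rewrite -polyC_eq0 -e.
  rewrite fE rmorphM; congr (_ * _); apply: (mulfI (t_neq0 b10)).
  by rewrite divff ?t_neq0 // -rmorphM {1}e -polyCM divff // rmorph1.
have [q [mq iq qb]] := irreducible_factor sb.
have [c [d [d0 [nqd e]]]] := Of q mq iq.
have := t_cross t_eq0 b10 d0 (etrans (esym fE) e) => E.
have : q %| a1 * d by rewrite E dvdp_mull.
rewrite irreducible_dvdM // (negPf nqd) orbF => qa.
have : q %| gcdp a1 b1 by rewrite dvdp_gcd qa.
rewrite -gcdp_eqp1 in co; rewrite (eqp_dvdr _ co) dvdp1.
by case: iq => q1 _; rewrite gtn_eqF.
Qed.

Lemma intGL_fin r a b c d : irreducible_poly r -> ~~ (r %| a * d - b * c) ->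
  intGL (finO t r) (mx2 (t a) (t b) (t c) (t d)).
Proof.
move=> irr nr; have det0 : a * d - b * c != 0 by apply: contraNneq nr => ->; rewrite dvdp0.
have Op := fun a => @finO_poly _ _ t _ a irr.
apply: (intGL_mx2 (finO_dvr t_eq0 t_frac irr)) => //;
  rewrite -!rmorphM -rmorphB ?t_eq0 //.
exact/(finO_invP t_eq0).
Qed.

(** Both columns lie in the lattice of the slope [l], and their determinant has the right valuation
    at [q], so they form a local basis of it. The scalar [q^-1] compensates for [nbr_mx] describing
    this lattice only up to homothety. *)
Lemma intGL_fin_lattice q l u1 u2 v1 v2 (c0 : k) : irreducible_poly q ->
  q %| u1 + l * v1 -> q %| u2 + l * v2 -> c0 != 0 ->
  u1 * v2 - u2 * v1 = c0 *: q ->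
  exists2 e : F, e != 0 & intGL (finO t q)
    (e *: (mx2 1 (t l) 0 (t q) * mx2 (t u1) (t u2) (t v1) (t v2))).
Proof.
move=> irr /dvdp_factor[w1 E1] /dvdp_factor[w2 E2] c00 det.
have q0 := irredp_neq0 irr; have tq0 := t_neq0 q0.
exists (t q)^-1; first by rewrite invr_eq0.
rewrite mx2M mx2Z.
have -> : mx2 ((t q)^-1 * (1 * t u1 + t l * t v1))
  ((t q)^-1 * (1 * t u2 + t l * t v2)) ((t q)^-1 * (0 * t u1 + t q * t v1))
  ((t q)^-1 * (0 * t u2 + t q * t v2)) = mx2 (t w1) (t w2) (t v1) (t v2).
  rewrite !mul1r !mul0r !add0r !mulKf // -!rmorphM -!rmorphD E1 E2 !rmorphM /=.
  by rewrite ![_ * t q]mulrC !mulKf.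
apply: intGL_fin => //.
have : (w1 * v2 - w2 * v1) * q = c0 *: q.
  rewrite -det mulrBl (mulrAC w1) (mulrAC w2) -E1 -E2; ring.
rewrite -mul_polyC => /(mulIf q0) ->.
by rewrite -alg_polyC dvdpZr // dvdp1 gtn_eqF //; case: irr.
Qed.

Lemma infO_pow a n : infO t (t a * (t 'X)^-1 ^+ n) <-> (size a <= n.+1)%N.
Proof.
by rewrite exprVn -rmorphXn (infO_poly_div t_eq0) ?expf_neq0 // size_polyXn.
Qed.

Lemma intGL_inf a b c d n1 n2 n3 n4 :
  (size a <= n1.+1)%N -> (size b <= n2.+1)%N -> (size c <= n3.+1)%N ->
  (size d <= n4.+1)%N -> (n1 + n4 = n2 + n3)%N ->
  size (a * d - b * c) = (n1 + n4).+1 ->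
  intGL (infO t) (mx2 (t a * (t 'X)^-1 ^+ n1) (t b * (t 'X)^-1 ^+ n2)
                      (t c * (t 'X)^-1 ^+ n3) (t d * (t 'X)^-1 ^+ n4)).
Proof.
move=> sa sb sc sd e sdet.
have det0 : a * d - b * c != 0 by rewrite -size_poly_gt0 sdet.
have E : t a * (t 'X)^-1 ^+ n1 * (t d * (t 'X)^-1 ^+ n4) -
  t b * (t 'X)^-1 ^+ n2 * (t c * (t 'X)^-1 ^+ n3) =
  t (a * d - b * c) / t ('X^(n1 + n4)).
  rewrite mulrACA -exprD mulrACA -exprD -e -mulrBl -!rmorphM -rmorphB.
  by rewrite exprVn -rmorphXn.
apply: (intGL_mx2 (infO_dvr t_eq0 t_frac)); rewrite ?infO_pow // E.
  by rewrite mulf_neq0 ?invr_eq0 ?t_neq0 // expf_neq0.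
by rewrite invf_div; apply/(infO_poly_div t_eq0); rewrite ?size_polyXn ?sdet.
Qed.

Lemma mx2_diagV (x : F) : x != 0 -> (mx2 x 0 0 1)^-1 = mx2 x^-1 0 0 1.
Proof.
move=> x0; have [|_ ->] := @unit_inv_of_mul _ (mx2 x 0 0 1) (mx2 x^-1 0 0 1) => //.
by rewrite mx2M !mulr0 !mul0r !addr0 add0r mulr1 divff // mx2_1.
Qed.

Lemma intGL_inf_lattice q (u1 u2 v1 v2 : {poly k}) (c0 : k) (i m1 m2 : nat) :
  (size u1 <= (i + m1).+1)%N -> (size v1 <= m1.+1)%N ->
  (size u2 <= (i + m2).+1)%N -> (size v2 <= m2.+1)%N -> (m1 <= m2)%N ->
  c0 != 0 -> u1 * v2 - u2 * v1 = c0 *: q -> size q = (i + m1 + m2).+1 ->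
  exists2 e : F, e != 0 & intGL (infO t) (e *: (mx2 ((t 'X)^-1 ^+ i) 0 0 1 *
    mx2 (t u1) (t u2) (t v1) (t v2) * (mx2 ((t 'X)^-1 ^+ (m2 - m1)) 0 0 1)^-1)).
Proof.
move=> su1 sv1 su2 sv2 m12 c00 det sq.
(* With [y] the inverse of [X], the entries become [u1 y^(i+m1)], [u2 y^(i+m2)], [v1 y^m1] and
   [v2 y^m2]: integral by the weight bounds. The determinant is a unit because [deg q] is exactly
   [i + m1 + m2]. *)
exists ((t 'X)^-1 ^+ m2); first by rewrite expf_neq0 // invr_eq0.
rewrite mx2_diagV ?expf_neq0 ?invr_eq0 // !mx2M mx2Z.
have := @intGL_inf u1 u2 v1 v2 (i + m1) (i + m2) m1 m2 su1 su2 sv1 sv2.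
rewrite det size_scale // sq => /(_ (ltac:(lia)) (erefl _)); congr intGL.
have -> : m2 = (m2 - m1 + m1)%N by rewrite subnK.
rewrite addnK !exprD; set y := (t 'X)^-1; have y0 : y != 0 by rewrite invr_eq0.
by congr mx2; field; rewrite ?y0 ?expf_neq0 ?y0.
Qed.

(** When [deg q <= i], the basis [(q, 0)], [(-l, 1)] is already reduced, with minima [deg q - i] and
    [0]. The first is not positive, so this case is kept apart from the reduction, whose weights are
    natural numbers. *)
Lemma intGL_inf_small q l (i : nat) :
  (size l <= (size q).-1)%N -> ((size q).-1 <= i)%N -> q != 0 ->
  intGL (infO t) (mx2 ((t 'X)^-1 ^+ i) 0 0 1 * mx2 (t q) (t (- l)) (t 0) (t 1) *
    (mx2 ((t 'X)^-1 ^+ (i - (size q).-1)) 0 0 1)^-1).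
Proof.
set d := (size q).-1 => sl di q0; have sq : size q = d.+1.
  by rewrite /d prednK // size_poly_gt0.
rewrite mx2_diagV ?expf_neq0 ?invr_eq0 // !mx2M !(rmorph0, rmorph1).
rewrite (_ : mx2 _ _ _ _ = mx2 (t q * (t 'X)^-1 ^+ d) (t (- l) * (t 'X)^-1 ^+ i) 0 1); last first.
  have -> : (t 'X)^-1 ^+ i = (t 'X)^-1 ^+ (i - d) * (t 'X)^-1 ^+ d.
    by rewrite -exprD subnK.
  set y := (t 'X)^-1; have y0 : y != 0 by rewrite invr_eq0.
  by congr mx2; field; rewrite ?y0 ?expf_neq0 ?y0.
have D := infO_dvr t_eq0 t_frac.
have E : t q * (t 'X)^-1 ^+ d * 1 - t (- l) * (t 'X)^-1 ^+ i * 0 = t q / t 'X^d.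
  by rewrite mulr1 mulr0 subr0 exprVn -rmorphXn.
apply: (intGL_mx2 D); rewrite ?infO_pow ?sq ?size_polyN ?E //.
- by apply: leq_trans sl _; apply: leqW.
- exact: dvr0 D.
- exact: dvr1 D.
- by rewrite mulf_neq0 ?invr_eq0 ?t_neq0 // expf_neq0.
- by rewrite invf_div; apply/(infO_poly_div t_eq0); rewrite ?size_polyXn ?sq.
Qed.

Lemma intGL_inf_diag q (i : nat) : q != 0 ->
  intGL (infO t) (mx2 ((t 'X)^-1 ^+ i) 0 0 1 * mx2 (t q)^-1 0 0 1 *
    (mx2 ((t 'X)^-1 ^+ (i + (size q).-1)) 0 0 1)^-1).
Proof.
set d := (size q).-1 => q0; have sq : size q = d.+1.
  by rewrite /d prednK // size_poly_gt0.
rewrite mx2_diagV ?expf_neq0 ?invr_eq0 // !mx2M.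
rewrite (_ : mx2 _ _ _ _ = mx2 (t 'X^d / t q) 0 0 1); last first.
  rewrite rmorphXn exprD !exprVn /=.
  by congr mx2; field; rewrite ?(t_neq0 q0) ?(expf_neq0 _ tX0) ?oner_neq0.
have D := infO_dvr t_eq0 t_frac.
have E : t 'X^d / t q * 1 - 0 * 0 = t 'X^d / t q by rewrite mulr1 mulr0 subr0.
apply: (intGL_mx2 D); rewrite ?E //; try exact: dvr0 D.
- by apply/(infO_poly_div t_eq0); rewrite ?size_polyXn ?sq.
- exact: dvr1 D.
- by rewrite mulf_neq0 ?invr_eq0 ?t_neq0 // expf_neq0.
- by rewrite invf_div; apply/(infO_poly_div t_eq0); rewrite ?expf_neq0 ?size_polyXn ?sq.
Qed.

Lemma inf_nbr_diag (i : nat) : mx2 (t 'X)^-1 0 0 1 * mx2 ((t 'X)^-1 ^+ i) 0 0 1 * 1 *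
  (mx2 ((t 'X)^-1 ^+ i.+1) 0 0 1)^-1 = 1.
Proof.
rewrite mulr1 mx2_diagV ?expf_neq0 ?invr_eq0 // !mx2M mx2_1 exprS.
set y := (t 'X)^-1; have y0 : y != 0 by rewrite invr_eq0.
by congr mx2; field; rewrite ?y0 ?expf_neq0.
Qed.

(** The slope is cleared by a shear with polynomial entries, invertible at all finite places; what
    remains is diagonal. *)
Lemma inf_nbr_pos (i : nat) l :
  t 'X *: (mx2 1 (t l) 0 (t 'X)^-1 * mx2 ((t 'X)^-1 ^+ i.+1) 0 0 1 *
    mx2 (t 1) (t (- (l * 'X ^+ i.+1))) (t 0) (t 1) *
    (mx2 ((t 'X)^-1 ^+ i) 0 0 1)^-1) = 1.
Proof.
rewrite mx2_diagV ?expf_neq0 ?invr_eq0 // !mx2M mx2Z mx2_1.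
rewrite !(rmorph0, rmorph1, rmorphN, rmorphM, rmorphXn) /= !exprVn !exprS.
by congr mx2; field; rewrite ?(expf_neq0 _ tX0) ?tX0 ?oner_neq0.
Qed.

Lemma inf_nbr_zero l :
  mx2 1 (t l) 0 (t 'X)^-1 * mx2 ((t 'X)^-1 ^+ 0) 0 0 1 *
    mx2 (t (- l)) (t 1) (t 1) (t 0) * (mx2 ((t 'X)^-1 ^+ 1) 0 0 1)^-1 = mx2 0 1 1 0.
Proof.
rewrite mx2_diagV ?expf_neq0 ?invr_eq0 // !mx2M.
rewrite !(rmorph0, rmorph1, rmorphN) /= expr0 expr1 invrK.
by congr mx2; field; rewrite ?tX0 ?expf_neq0.
Qed.

Lemma infO_big a (i j : nat) : (i < j)%N ->
  infO t (t 'X ^+ j * t a * (t 'X)^-1 ^+ i) -> a = 0.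
Proof.
move=> ij; rewrite -rmorphXn -rmorphM infO_pow => sz; apply/eqP.
apply: contraTT sz => a0; rewrite -ltnNge mulrC size_mulXn //.
by rewrite -size_poly_gt0 in a0; move: ij a0; lia.
Qed.

(** The order of type [j] contains [X^j] times the nonzero matrix [E_01]. After conjugation [E_01]
    becomes a matrix [n] regular at all finite places, hence polynomial. For [i < j], having [X^j n]
    in the order of type [i] at infinity forces every entry of [n] to vanish. *)
Lemma not_iso_diag (h : 'M[F]_2) (i j : nat) : h \in unitmx -> (i < j)%N ->
  (forall q, q \is monic -> irreducible_poly q ->
     intM (finO t q) (h^-1 * mx2 0 1 0 0 * h)) ->
  ~ conj_order (infO t) (mx2 ((t 'X)^-1 ^+ i) 0 0 1) (h^-1 * mx2 0 (t 'X ^+ j) 0 0 * h).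
Proof.
move=> uh ij fin.
have D := infO_dvr t_eq0 t_frac.
have -> : mx2 0 (t 'X ^+ j) 0 0 = t 'X ^+ j *: mx2 0 1 0 0.
  by rewrite mx2Z !mulr0 mulr1.
rewrite -scalerAr -scalerAl; move E: (h^-1 * mx2 0 1 0 0 * h) fin => n fin.
move/(conj_order_diag D); rewrite !mxE => -[O00 O01 O10 O11].
have poly (k0 l0 : 'I_2) : exists a, n k0 l0 = t a by apply: finO_all_poly => q mq iq; apply: fin.
have [a aE] := poly 0 0; have [b bE] := poly 0 1.
have [c cE] := poly 1 0; have [d dE] := poly 1 1.
have j0 : (0 < j)%N by apply: leq_ltn_trans ij.
have a0 : a = 0 by apply: (@infO_big a 0 j) => //; rewrite expr0 mulr1 -aE.
have d0 : d = 0 by apply: (@infO_big d 0 j) => //; rewrite expr0 mulr1 -dE.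
have b0 : b = 0 by apply: (@infO_big b i j) => //; rewrite -bE.
have c0 : c = 0.
  apply: (@infO_big c 0 (j + i)); first by rewrite addn_gt0 j0.
  by rewrite expr0 mulr1 exprD mulrAC -cE -[t 'X ^+ i]invrK -exprVn.
have n0 : n = mx2 0 0 0 0.
  by rewrite (mx2_eta n) aE bE cE dE a0 b0 c0 d0 !rmorph0.
have : mx2 0 1 0 0 = h * n * h^-1 by rewrite -E !mulrA mulrV // mul1r mulrK.
rewrite n0; have -> : mx2 0 0 0 0 = 0 :> 'M[F]_2 by apply: eq_mx2; rewrite mx2C mxE.
move=> /(congr1 (fun m : 'M__ => m 0 1)) /eqP.
by rewrite mulr0 mul0r mx2C mxE oner_eq0.
Qed.

End RatFunGL.

(** * Isomorphism types of the neighbors *)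

Lemma intGL_div1 (F : fieldType) (O : F -> Prop) (m : 'M[F]_2) :
  intGL O m -> exists2 e, e != 0 & intGL O (e *: (m / 1)).
Proof. by exists 1; rewrite ?oner_neq0 // scale1r invr1 mulr1. Qed.

Lemma intGL_scale1 (F : fieldType) (O : F -> Prop) (m : 'M[F]_2) :
  intGL O m -> exists2 e, e != 0 & intGL O (e *: m).
Proof. by exists 1; rewrite ?oner_neq0 // scale1r. Qed.

Lemma intGL_1mul (F : fieldType) (O : F -> Prop) (m : 'M[F]_2) :
  intGL O m -> intGL O (1 * m).
Proof. by rewrite mul1r. Qed.

Lemma intGL_mul1 (F : fieldType) (O : F -> Prop) (m : 'M[F]_2) :
  intGL O m -> intGL O (m * 1).
Proof. by rewrite mulr1. Qed.

Lemma conj_conj (F : fieldType) (g h x : 'M[F]_2) : g \in unitmx -> h \in unitmx ->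
  g^-1 * ((h * g^-1)^-1 * x * (h * g^-1)) * g = h^-1 * x * h.
Proof.
move=> ug uh; rewrite invrM ?unitrV // invrK !mulrA mulVr // mul1r.
by rewrite mulrVK.
Qed.

Lemma conj_conjV (F : fieldType) (g x : 'M[F]_2) : g \in unitmx ->
  g * (g^-1 * x * g) * g^-1 = x.
Proof. by move=> ug; rewrite !mulrA mulrV // mul1r mulrK. Qed.

Lemma unitmx_mulr (F : fieldType) (g h : 'M[F]_2) :
  g \in unitmx -> h \in unitmx -> g * h \in unitmx.
Proof. by move=> ug uh; rewrite unitmx_mul ug. Qed.

Lemma unitmx_1r (F : fieldType) : (1 : 'M[F]_2) \in unitmx.
Proof. exact: unitmx1. Qed.

Lemma intGL_Zmul1 (F : fieldType) (O : F -> Prop) (m w : 'M[F]_2) :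
  (exists2 e, e != 0 & intGL O (e *: (m * w))) ->
  exists2 e, e != 0 & intGL O (e *: (m * 1 * w / 1)).
Proof. by case=> e e0 GL; exists e; rewrite ?oner_neq0 // invr1 !mulr1. Qed.

Lemma diag_mulV (F : fieldType) (x : F) : x != 0 ->
  mx2 x 0 0 1 * mx2 x^-1 0 0 1 = 1.
Proof. by move=> x0; rewrite mx2M !mulr0 !mul0r !addr0 add0r mulr1 divff // mx2_1. Qed.

Lemma diag_mul (F : fieldType) (x y : F) n :
  mx2 (x ^+ n) 0 0 1 * mx2 (y ^+ n) 0 0 1 = mx2 ((x * y) ^+ n) 0 0 1.
Proof. by rewrite mx2M !mulr0 !mul0r !addr0 add0r mulr1 exprMn. Qed.

Lemma intGL_diag (F : fieldType) (O : F -> Prop) (pi : F) : is_dvr O pi ->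
  forall (f : F) n, f != 0 -> O f -> O f^-1 -> intGL O (mx2 (f ^+ n) 0 0 1).
Proof.
move=> D f n f0 Of OfV; have O0 := dvr0 D; have O1 := dvr1 D.
have E : f ^+ n * 1 - 0 * 0 = f ^+ n by rewrite mulr1 mulr0 subr0.
apply: (intGL_mx2 D); rewrite ?E ?expf_neq0 //; first exact: (dvrX D).
by rewrite -exprVn; apply: (dvrX D).
Qed.

Lemma intGL_diagV (F : fieldType) (O : F -> Prop) (pi : F) : is_dvr O pi ->
  forall f : F, f != 0 -> O f -> O f^-1 -> intGL O (mx2 f^-1 0 0 1).
Proof.
move=> D f f0 Of OfV; rewrite -[f^-1]expr1.
by apply: (intGL_diag D); rewrite ?invrK ?invr_eq0.
Qed.

Lemma infO_linear (k F : fieldType) (t : {rmorphism {poly k} -> F}) :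
  (forall a, (t a == 0) = (a == 0)) -> forall y : {poly k}, size y = 2 ->
  infO t (t y * (t 'X)^-1) /\ infO t (t y * (t 'X)^-1)^-1.
Proof.
move=> t_eq0 y sy; have y0 : y != 0 by rewrite -size_poly_gt0 sy.
have X0 : 'X != 0 :> {poly k} by rewrite polyX_eq0.
rewrite invf_div; split; first by apply/(infO_poly_div t_eq0 _ X0); rewrite sy size_polyX.
by apply/(infO_poly_div t_eq0 _ y0); rewrite sy size_polyX.
Qed.

Lemma monic_irreducible_dvd (k : fieldType) (r q : {poly k}) :
  r \is monic -> irreducible_poly r -> q \is monic -> irreducible_poly q ->
  r %| q -> r = q.
Proof.
move=> mr [r1 _] mq [_ iq] rq; apply/eqP; rewrite -eqp_monic //.
by apply: iq rq; rewrite gtn_eqF.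
Qed.

Section IsoTypes.
Variable p : nat.
Implicit Types (P R : option {poly 'F_p}) (x g h : Mat p) (D : Xfam p).

(* [fam (ainf i)] is the family of stalks of [D_(i oo)]. *)
Definition ainf (i : nat) R : Mat p :=
  if R is None then mx2 (unif None ^+ i) 0 0 1 else 1.

Lemma ainf_unit i R : ainf i R \in unitmx.
Proof.
case: R => [q|]; first exact: unitmx_1r.
apply/unitmx_diag/expf_neq0; exact: unif_neq0 (@place_dvr p None I).
Qed.

(** One global [g] has to match the lattices at all places, but the scalar [e] may vary with the
    place. *)
Lemma Xiso_crit a b g : (forall R, is_place R -> a R \in unitmx) ->
  (forall R, is_place R -> b R \in unitmx) -> g \in unitmx ->
  (forall R, is_place R ->
     exists2 e, e != 0 & intGL (locO R) (e *: (a R * g * (b R)^-1))) ->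
  Xiso (fam a) (fam b).
Proof.
move=> ua ub ug GL; apply/(Xiso_famE b ua); exists g; split=> [|R plR x]; first exact: ug.
have [e e0 GLe] := GL R plR.
exact: (conj_order_of_intGL (place_dvr plR) x e0 (unitmx_mulr (ua R plR) ug) (ub R plR) GLe).
Qed.

Lemma Xiso_cancel D D1 D2 : Xiso D D1 -> Xiso D D2 -> Xiso D1 D2.
Proof.
move=> [g1 [ug1 e1]] [g2 [ug2 e2]]; exists (g2 * g1^-1); split.
  exact: unitmx_mulr ug2 (unitmx_invr ug1).
move=> R plR x; apply: iff_trans (e2 R plR x) _.
apply: iff_sym; apply: iff_trans (e1 R plR _) _.
by have -> := conj_conj x ug1 ug2.
Qed.

Lemma Xiso_sym D1 D2 : Xiso D1 D2 -> Xiso D2 D1.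
Proof.
move=> iso; apply: Xiso_cancel iso _; exists 1; split; first exact: unitmx_1r.
by move=> R plR x; rewrite invr1 mul1r mulr1.
Qed.

Lemma Xiso_ainf_le i j : Xiso (fam (ainf i)) (fam (ainf j)) -> (j <= i)%N.
Proof.
move=> [h [uh eh]]; rewrite leqNgt; apply/negP => ij.
apply: (@not_iso_diag _ _ _ (@tfm_eq0 p) (@tfm_frac p) h i j uh ij).
  move=> q mq iq; have plq : is_place (Some q) by split.
  have [+ _] := eh (Some q) plq (mx2 0 1 0 0).
  have D := place_dvr plq.
  move=> /(_ _); rewrite /fam /= => H.
  apply/conj_order1; apply: H; apply/conj_order1.
  by apply: intM_mx2; first [exact: dvr0 D | exact: dvr1 D].
have [+ _] := eh None I (mx2 0 (tfm p 'X ^+ j) 0 0).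
apply; have D := @place_dvr p None I.
apply/(conj_order_diag D); rewrite !mx2C; split; try exact: dvr0 D.
  rewrite -exprMn; have -> : tfm p 'X * unif None = 1; last by rewrite expr1n; exact: dvr1 D.
  by apply: divff; rewrite tfm_eq0 polyX_eq0.
by rewrite mul0r; exact: dvr0 D.
Qed.

Lemma Xiso_ainfP D i j : Xiso D (fam (ainf i)) -> Xiso D (fam (ainf j)) <-> i = j.
Proof.
move=> isoi; split=> [isoj|<-//]; apply/eqP; rewrite eqn_leq.
rewrite (Xiso_ainf_le (Xiso_cancel isoj isoi)).
by rewrite (Xiso_ainf_le (Xiso_cancel isoi isoj)).
Qed.

Lemma upd_unit (a : option {poly 'F_p} -> Mat p) P o : is_place P ->
  (forall R, is_place R -> a R \in unitmx) ->
  forall R, is_place R -> @upd p a P o R \in unitmx.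
Proof.
move=> plP ua R plR; rewrite /upd; case: eqP => [_|_]; last exact: ua.
apply: unitmx_mulr; last exact: ua.
exact: (nbr_mx_unit (place_dvr plP)).
Qed.

Lemma upd_same (a : option {poly 'F_p} -> Mat p) P o :
  @upd p a P o P = nbr_mx (unif P) (@place_rep p P) o * a P.
Proof. by rewrite /upd eqxx. Qed.

Lemma upd_other (a : option {poly 'F_p} -> Mat p) P o R : R != P -> @upd p a P o R = a R.
Proof. by rewrite /upd => /negPf ->. Qed.

Lemma intGL_poly q a b c d : irreducible_poly q -> ~~ (q %| a * d - b * c) ->
  intGL (locO (Some q)) (mx2 (tfm p a) (tfm p b) (tfm p c) (tfm p d)).
Proof. exact: (intGL_fin (@tfm_eq0 p) (@tfm_frac p)). Qed.

Lemma unitmx_poly (a b c d : {poly 'F_p}) : a * d - b * c != 0 ->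
  mx2 (tfm p a) (tfm p b) (tfm p c) (tfm p d) \in unitmx.
Proof. by move=> det0; rewrite unitmx2 -!rmorphM -rmorphB tfm_eq0. Qed.

Lemma Xiso_nbr_inf_None i :
  Xiso (fam (@upd p (ainf i) None None)) (fam (ainf i.+1)).
Proof.
have Pl : @is_place p None by [].
have ua := upd_unit None Pl (fun R _ => ainf_unit i R).
apply: (Xiso_crit ua (fun R _ => ainf_unit _ R) (unitmx_1r _)) => -[r|] plR.
  rewrite upd_other; last by [].
  apply: intGL_div1.
  apply: intGL_mul1; exact: intGL1 (place_dvr plR).
rewrite upd_same; apply: intGL_scale1.
have E := inf_nbr_diag (@tfm_eq0 p) i.
rewrite [X in intGL _ X](E : _ = 1); exact: intGL1 (place_dvr plR).
Qed.

(** Modulo isomorphism the tree at infinity is a ray. Its end vertex has type [0], from which all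
    neighbors have type [1]; elsewhere the affine points lead one step back. *)
Lemma Xiso_nbr_inf_Some i l :
  Xiso (fam (@upd p (ainf i) None (Some l))) (fam (ainf (if i is i'.+1 then i' else 1))).
Proof.
have Pl : @is_place p None by [].
have ua := upd_unit (Some l) Pl (fun R _ => ainf_unit i R).
case: i ua => [|i] ua.
  have nz : - val l * 0 - 1 * 1 != 0 :> {poly 'F_p}.
    by rewrite mulr0 mulr1 sub0r oppr_eq0 oner_neq0.
  apply: (Xiso_crit ua (fun R _ => ainf_unit _ R) (unitmx_poly nz)) => -[r|] plR.
    rewrite upd_other; last by [].
  apply: intGL_div1.
    apply: intGL_1mul; have [_ ir] := plR; apply: intGL_poly; first exact: ir.
    by rewrite mulr0 mulr1 sub0r dvdpNr dvdp1 gtn_eqF //; case: ir.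
  rewrite upd_same; apply: intGL_scale1.
  have E := inf_nbr_zero (@tfm_eq0 p) (val l).
  rewrite [X in intGL _ X](E : _ = mx2 0 1 1 0).
  have D := place_dvr plR; have O0 := dvr0 D; have O1 := dvr1 D.
  apply: (intGL_mx2 D O0 O1 O1 O0).
    by rewrite mulr0 mulr1 sub0r oppr_eq0 oner_neq0.
  by rewrite mulr0 mulr1 sub0r invrN1; apply: (dvrN D).
have nz : 1 * 1 - - (val l * 'X ^+ i.+1) * 0 != 0 :> {poly 'F_p}.
  by rewrite mulr0 mulr1 subr0 oner_neq0.
apply: (Xiso_crit ua (fun R _ => ainf_unit _ R) (unitmx_poly nz)) => -[r|] plR.
  rewrite upd_other; last by [].
  apply: intGL_div1.
  apply: intGL_1mul; have [_ ir] := plR; apply: intGL_poly; first exact: ir.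
  by rewrite mulr0 mulr1 subr0 dvdp1 gtn_eqF //; case: ir.
rewrite upd_same; exists (tfm p 'X); first by rewrite tfm_eq0 polyX_eq0.
have E := inf_nbr_pos (@tfm_eq0 p) i (val l).
rewrite [X in intGL _ X](E : _ = 1); exact: intGL1 (place_dvr plR).
Qed.

(** The global matrix [diag(q^-1, 1)] undoes the change at [q], is invertible at the other finite
    places, and raises the type by [deg q] at infinity. *)
Lemma Xiso_nbr_fin_None i q : is_place (Some q) ->
  Xiso (fam (@upd p (ainf i) (Some q) None)) (fam (ainf (i + (size q).-1))).
Proof.
move=> Pl; have [mq iq] := Pl; have q0 := irredp_neq0 iq.
have tq0 : tfm p q != 0 by rewrite tfm_eq0.
have ua := upd_unit None Pl (fun R _ => ainf_unit i R).
have ug : mx2 (tfm p q)^-1 0 0 1 \in unitmx by apply: unitmx_diag; rewrite invr_eq0.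
apply: (Xiso_crit ua (fun R _ => ainf_unit _ R) ug) => -[r|] plR; last first.
  rewrite upd_other; last by [].
  apply: intGL_scale1.
  exact: (intGL_inf_diag (@tfm_eq0 p) (@tfm_frac p) i q0).
have [erq|nrq] := eqVneq (Some r) (Some q).
  case: erq plR => -> plR; rewrite upd_same; apply: intGL_Zmul1; apply: intGL_scale1.
  rewrite [X in intGL _ X](diag_mulV tq0 : _ = 1); exact: intGL1 (place_dvr plR).
rewrite (upd_other _ _ nrq); apply: intGL_div1; apply: intGL_1mul.
have [mr ir] := plR; apply: (intGL_diagV (place_dvr plR) tq0).
  exact: (finO_poly (tfm p) q ir).
apply/(finO_invP (@tfm_eq0 p) ir q0); apply: contra nrq => rq.
by rewrite (monic_irreducible_dvd mr ir mq iq rq).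
Qed.

(** The global matrix is the lattice basis itself. Its determinant [c0 *: q] is a unit at every
    finite place other than [q], so only the condition at infinity is left as a hypothesis. *)
Lemma Xiso_nbr_fin_Some i j q l (u1 u2 v1 v2 : {poly 'F_p}) (c0 : 'F_p) :
  is_place (Some q) ->
  q %| u1 + val l * v1 -> q %| u2 + val l * v2 -> c0 != 0 ->
  u1 * v2 - u2 * v1 = c0 *: q ->
  (exists2 e, e != 0 & intGL (locO None) (e *: (ainf i None *
    mx2 (tfm p u1) (tfm p u2) (tfm p v1) (tfm p v2) * (ainf j None)^-1))) ->
  Xiso (fam (@upd p (ainf i) (Some q) (Some l))) (fam (ainf j)).
Proof.
move=> Pl q1 q2 c00 det inf; have [mq iq] := Pl; have q0 := irredp_neq0 iq.
have ua := upd_unit (Some l) Pl (fun R _ => ainf_unit i R).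
have nz : u1 * v2 - u2 * v1 != 0 by rewrite det scale_poly_eq0 negb_or c00.
apply: (Xiso_crit ua (fun R _ => ainf_unit _ R) (unitmx_poly nz)) => -[r|] plR; last first.
  by rewrite upd_other.
have [erq|nrq] := eqVneq (Some r) (Some q).
  case: erq plR => -> plR; rewrite upd_same; apply: intGL_Zmul1.
  exact: (intGL_fin_lattice (@tfm_eq0 p) (@tfm_frac p) iq q1 q2 c00 det).
rewrite (upd_other _ _ nrq); apply: intGL_div1; apply: intGL_1mul.
have [mr ir] := plR; apply: intGL_poly; first exact: ir.
rewrite det dvdpZr; last exact: c00.
 apply: contra nrq => rq.
by rewrite (monic_irreducible_dvd mr ir mq iq rq).
Qed.

Lemma Xiso_nbr_fin_small i (q : {poly 'F_p}) (l : {poly_((size q).-1) 'F_p}) : is_place (Some q) ->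
  ((size q).-1 <= i)%N ->
  Xiso (fam (@upd p (ainf i) (Some q) (Some l))) (fam (ainf (i - (size q).-1))).
Proof.
move=> Pl di; have [_ iq] := Pl; have q0 := irredp_neq0 iq.
apply: (@Xiso_nbr_fin_Some i _ q l q (- val l) 0 1 1); rewrite ?oner_neq0 //.
- by rewrite mulr0 addr0.
- by rewrite mulr1 addNr dvdp0.
- by rewrite mulr1 mulr0 subr0 scale1r.
apply: intGL_scale1.
exact: (intGL_inf_small (@tfm_eq0 p) (@tfm_frac p) (size_npoly l) di q0).
Qed.

Lemma Xiso_nbr_fin_lattice i m1 m2 (q : {poly 'F_p}) (l : {poly_((size q).-1) 'F_p})
    (u1 u2 v1 v2 : {poly 'F_p}) (c0 : 'F_p) : is_place (Some q) ->
  q %| u1 + val l * v1 -> q %| u2 + val l * v2 -> c0 != 0 ->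
  u1 * v2 - u2 * v1 = c0 *: q ->
  (size u1 <= (i + m1).+1)%N -> (size v1 <= m1.+1)%N ->
  (size u2 <= (i + m2).+1)%N -> (size v2 <= m2.+1)%N -> (m1 <= m2)%N ->
  size q = (i + m1 + m2).+1 ->
  Xiso (fam (@upd p (ainf i) (Some q) (Some l))) (fam (ainf (m2 - m1))).
Proof.
move=> Pl q1 q2 c00 det su1 sv1 su2 sv2 m12 sq.
apply: (Xiso_nbr_fin_Some Pl q1 q2 c00 det).
exact: (intGL_inf_lattice (@tfm_eq0 p) (@tfm_frac p) su1 sv1 su2 sv2 m12 c00 det sq).
Qed.

(* Conjugation by [bQ Q i] carries [D_(iQ)] to [D_(i oo)]. *)
Definition bQ (Q : option {poly 'F_p}) (i : nat) : Mat p :=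
  if Q is Some y then mx2 (tfm p y ^+ i) 0 0 1 else 1.

Lemma bQ_unit Q i : is_place Q -> bQ Q i \in unitmx.
Proof.
case: Q => [y [_ iy]|_]; last exact: unitmx_1r.
by apply/unitmx_diag/expf_neq0; rewrite tfm_eq0 irredp_neq0.
Qed.

(** For finite [Q] given by [y], the degree one makes [y / X] a unit at infinity, so the
    contributions of [ainf] and [bQ] cancel there. *)
Lemma ainf_bQ_GL Q i R : is_place Q -> place_deg Q = 1 -> is_place R -> R != Q ->
  intGL (locO R) (ainf i R * bQ Q i).
Proof.
move=> plQ dQ plR RQ; have D := place_dvr plR.
case: Q plQ dQ RQ => [y [my iy]|_] /= dQ RQ; last first.
  case: R plR RQ D => [r|//] plR _ D; apply: intGL_mul1; exact: intGL1 D.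
have y0 := irredp_neq0 iy; have ty0 : tfm p y != 0 by rewrite tfm_eq0.
case: R plR RQ D => [r|] plR RQ D.
  have [mr ir] := plR; apply: intGL_1mul; apply: (intGL_diag D i ty0).
    exact: (finO_poly (tfm p) y ir).
  apply/(finO_invP (@tfm_eq0 p) ir y0); apply: contra RQ => ry.
  by rewrite (monic_irreducible_dvd mr ir my iy ry).
rewrite [X in intGL _ X](diag_mul (unif None) (tfm p y) i).
have sy : size y = 2 by case: (iy); case: (size y) dQ => [|[|[|]]].
have [Oy OyV] := infO_linear (@tfm_eq0 p) sy.
rewrite [unif None * _]mulrC.
exact: (intGL_diag D i (mulf_neq0 ty0 (unif_neq0 D)) Oy OyV).
Qed.

Lemma D_iQ_fam Q i : is_place Q -> place_deg Q = 1 ->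
  Xeq (D_iQ Q i) (fam (fun R => ainf i R * bQ Q i)).
Proof.
move=> plQ dQ R plR x; rewrite /D_iQ /fam; case: eqVneq => [->|RQ].
  apply: iff_trans (valmatE i x plQ) _.
  have -> : ainf i Q * bQ Q i = mx2 (unif Q ^+ i) 0 0 1; last by [].
  by case: (Q) => [y|]; [exact: mul1r | exact: mulr1].
apply: iff_trans (M2OE R x) (iff_sym _).
exact: (conj_order_intGL (place_dvr plR) x (ainf_bQ_GL i plQ dQ plR RQ)).
Qed.

Lemma ainf_bQ_adelic Q i : is_place Q -> place_deg Q = 1 ->
  adelic (fun R => ainf i R * bQ Q i).
Proof.
move=> plQ dQ; split=> [R _|]; first exact: unitmx_mulr (ainf_unit i R) (bQ_unit i plQ).
by exists [:: Q] => R plR; rewrite inE; apply: ainf_bQ_GL.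
Qed.

Lemma Xiso_fam_mulr a b b' : (forall R, is_place R -> a R \in unitmx) -> b \in unitmx ->
  (forall R, is_place R -> b' R = a R * b) -> Xiso (fam b') (fam a).
Proof.
move=> ua ub E; exists b; split; first exact: ub.
move=> R plR x; rewrite /fam (E R plR); apply: iff_sym.
apply: iff_trans (conj_orderM _ _ (ua R plR) ub) _.
have -> := conj_conjV x ub; exact: iff_refl.
Qed.

Lemma N_is_type Q P i j (typ : option {poly_(place_deg P) 'F_p} -> nat) :
  is_place Q -> place_deg Q = 1 -> is_place P ->
  (forall o, Xiso (fam (@upd p (ainf i) P o)) (fam (ainf (typ o)))) ->
  N_is P (D_iQ Q i) (D_iQ Q j) #|[pred o | typ o == j]|.
Proof.
move=> plQ dQ plP typP.
apply: (N_is_fam plP (ainf_bQ_adelic i plQ dQ) (D_iQ_fam i plQ dQ)) => o.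
have iso1 : Xiso (fam (upd (fun R => ainf i R * bQ Q i) o)) (fam (@upd p (ainf i) P o)).
  apply: (Xiso_fam_mulr (upd_unit o plP (fun R _ => ainf_unit i R)) (bQ_unit i plQ)).
  by move=> R plR; rewrite /upd; case: eqP => // _; exact: mulrA.
have iso2 : Xiso (fam (upd (fun R => ainf i R * bQ Q i) o)) (fam (ainf (typ o))).
  exact: Xiso_cancel (Xiso_sym iso1) (typP o).
have iso3 : Xiso (D_iQ Q j) (fam (ainf j)).
  apply: (Xiso_Xeql (D1 := fam (fun R => ainf j R * bQ Q j))).
    by move=> R plR x; apply: iff_sym (D_iQ_fam j plQ dQ plR x).
  by apply: (Xiso_fam_mulr (fun R _ => ainf_unit j R) (bQ_unit j plQ)).
rewrite inE; split=> [iso|/eqP ej].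
  apply/eqP/(Xiso_ainfP _ iso2).
  exact: Xiso_cancel (Xiso_sym iso) iso3.
by rewrite ej in iso2; exact: Xiso_cancel (Xiso_sym iso2) (Xiso_sym iso3).
Qed.

End IsoTypes.

(** * Reduced lattice bases *)

Lemma size_polyB_leq (k : fieldType) (a b : {poly k}) n :
  (size a <= n)%N -> (size b <= n)%N -> (size (a - b)%R <= n)%N.
Proof.
by move=> an bn; apply: leq_trans (size_polyD _ _) _; rewrite size_polyN geq_max an.
Qed.

Lemma coefM_top (k : fieldType) (a b : {poly k}) m n :
  (size a <= m.+1)%N -> (size b <= n.+1)%N -> (a * b)`_(m + n) = a`_m * b`_n.
Proof.
move=> am bn; have mn : (m < (m + n).+1)%N by rewrite ltnS leq_addr.
rewrite coefM (bigD1 (Ordinal mn)) //= addKn big1 ?addr0 // => j /eqP nj.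
have [jm|mj|e] := ltngtP (nat_of_ord j) m; last by case: nj; apply: val_inj.
  rewrite [b`__]nth_default ?mulr0 //; apply: leq_trans bn _; lia.
by rewrite [a`__]nth_default ?mul0r //; apply: leq_trans am _.
Qed.

Lemma size_drop_top (k : fieldType) (a : {poly k}) n :
  (size a <= n.+1)%N -> a`_n = 0 -> (size a <= n)%N.
Proof.
move=> an a0; apply/leq_sizeP => j; rewrite leq_eqVlt => /predU1P[<-//|nj].
by rewrite nth_default // (leq_trans an).
Qed.

Section Lattice.
Variables (k : fieldType) (q l : {poly k}) (i : nat).
Implicit Types (u v : {poly k}).

(* [(u1, v1)] and [(u2, v2)] span the lattice [u + l v = 0 mod q]; the weight of
   a vector [(u, v)] is the maximum of [deg u - i] and [deg v]. *)
Definition lattice_basis (m1 m2 : nat) u1 u2 v1 v2 (c : k) : Prop :=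
  [/\ q %| u1 + l * v1, q %| u2 + l * v2, c != 0 & u1 * v2 - u2 * v1 = c *: q] /\
  [/\ (size u1 <= (i + m1).+1)%N, (size v1 <= m1.+1)%N,
      (size u2 <= (i + m2).+1)%N & (size v2 <= m2.+1)%N].

Definition has_basis m1 m2 := exists u1 u2 v1 v2 c, lattice_basis m1 m2 u1 u2 v1 v2 c.

Lemma has_basisC m1 m2 : has_basis m1 m2 -> has_basis m2 m1.
Proof.
case=> u1 [u2 [v1 [v2 [c [[q1 q2 c0 det] [s1 s2 s3 s4]]]]]].
exists u2, u1, v2, v1, (- c); split; split=> //; first by rewrite oppr_eq0.
by rewrite scaleNr -det; ring.
Qed.

Hypothesis q0 : q != 0.
Hypothesis iq : (i.+1 < size q)%N.

(* If the weights exceed the degree of the determinant, the leading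
   coefficients are proportional and one of the two vectors can be shortened. *)
Lemma has_basis_reduce m1 m2 : (m1 <= m2)%N -> (size q <= i + m1 + m2)%N ->
  has_basis m1 m2 ->
  (exists2 m, m1 = m.+1 & has_basis m m2) \/ (exists2 m, m2 = m.+1 & has_basis m1 m).
Proof.
move=> m12 sq [u1 [u2 [v1 [v2 [c [[q1 q2 c0 det] [s1 s2 s3 s4]]]]]]].
have top : u1`_(i + m1) * v2`_m2 = u2`_(i + m2) * v1`_m1.
  apply/eqP; rewrite -subr_eq0 -!coefM_top // -[(i + m2 + m1)%N]addnAC -coefB det coefZ.
  by rewrite nth_default ?mulr0.
have det0 : u1 * v2 - u2 * v1 != 0 by rewrite det scale_poly_eq0 negb_or c0.
have [[a0 b0]|nz] := classic (u1`_(i + m1) = 0 /\ v1`_m1 = 0).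
  left; have s1' := size_drop_top s1 a0; have s2' := size_drop_top s2 b0.
  (* A weight [0] cannot drop: [v1] would be [0], and [q] would divide [u1], whose degree is
     smaller. *)
  case: m1 {s1 s2 m12 sq top a0 b0} s1' s2' => [|m] s1' s2'; last first.
    by exists m => //; exists u1, u2, v1, v2, c; split; split=> //; rewrite ?addnS in s1' *.
  have v10 : v1 = 0 by apply/eqP; rewrite -size_poly_leq0.
  have u10 : u1 = 0.
    apply/eqP; apply: contraT => u10; move: q1; rewrite v10 mulr0 addr0.
    move/(dvdp_size_leq u10) => sq; move: (leq_trans sq s1'); move: iq; lia.
  by case/eqP: det0; rewrite v10 u10 mulr0 mul0r subr0.
right; have [mu [e1 e2]] : exists mu, u2`_(i + m2) = mu * u1`_(i + m1) /\
    v2`_m2 = mu * v1`_m1.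
  have [a0|a0] := eqVneq (u1`_(i + m1)) 0.
    have b0 : v1`_m1 != 0 by apply/eqP => b0; apply: nz.
    exists (v2`_m2 / v1`_m1); rewrite divfK // a0 mulr0; split=> //.
    move/eqP: top; rewrite a0 mul0r eq_sym mulf_eq0 (negPf b0) orbF => /eqP//.
  exists (u2`_(i + m2) / u1`_(i + m1)); rewrite divfK //; split=> //.
  by rewrite mulrAC -top mulrAC divff // mul1r.
case: m2 m12 sq s3 s4 top e1 e2 => [|m] m12 sq s3 s4 top e1 e2.
  by move: iq sq m12; lia.
exists m => //; set x := mu *: 'X^(m.+1 - m1).
have coefx (a : {poly k}) n : (x * a)`_(n + (m.+1 - m1)) = mu * a`_n.
  by rewrite -scalerAl coefZ coefXnM ltnNge leq_addl /= addnK.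
have sx (a : {poly k}) n : (size a <= n.+1)%N -> (size (x * a)%R <= (n + (m.+1 - m1)).+1)%N.
  move=> sa; have sX : (size x <= (m.+1 - m1).+1)%N.
    by apply: leq_trans (size_scale_leq _ _) _; rewrite size_polyXn.
  by apply: leq_trans (size_polyM_leq sX sa) _; lia.
have E1 : (i + m1 + (m.+1 - m1) = i + m.+1)%N by move: m12; lia.
have E2 : (m1 + (m.+1 - m1) = m.+1)%N by move: m12; lia.
exists u1, (u2 - x * u1), v1, (v2 - x * v1), c; split; split=> //.
- rewrite (_ : _ + _ = u2 + l * v2 - x * (u1 + l * v1)); last by ring.
  by apply: dvdp_sub => //; apply: dvdp_mull.
- by rewrite -det; ring.
- rewrite -addnS; apply: size_drop_top; last by rewrite coefB -E1 coefx E1 e1 subrr.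
  by apply: size_polyB_leq => //; rewrite -E1; apply: sx.
- apply: size_drop_top; last by rewrite coefB -{2}E2 coefx e2 subrr.
  by apply: size_polyB_leq => //; rewrite -E2; apply: sx.
Qed.

(** Each reduction lowers [m1 + m2] by one, and it is possible as long as [i + m1 + m2] exceeds
    [deg q]. The descent therefore stops exactly at equality. *)
Lemma has_basis_reduced m1 m2 : (size q <= (i + m1 + m2).+1)%N -> has_basis m1 m2 ->
  exists m1' m2', [/\ (m1' <= m2')%N, size q = (i + m1' + m2').+1 & has_basis m1' m2'].
Proof.
move: {2}(m1 + m2)%N (leqnn (m1 + m2)) => n; elim: n m1 m2 => [|n IH] m1 m2 mn sq B.
  have [e1 e2] : m1 = 0%N /\ m2 = 0%N by move: mn; lia.
  by subst; move: iq sq; lia.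
wlog m12 : m1 m2 mn sq B / (m1 <= m2)%N.
  move=> H; have [|/ltnW] := leqP m1 m2; first exact: H.
  by apply: H; rewrite ?(addnC m2) ?(addnAC i m2) //; apply: has_basisC.
have [e|ne] := eqVneq (size q) (i + m1 + m2).+1; first by exists m1, m2.
have sq' : (size q <= i + m1 + m2)%N by move: sq ne; lia.
have [[m e B']|[m e B']] := has_basis_reduce m12 sq' B.
  by apply: (IH m m2) => //; subst m1; move: mn sq'; lia.
by apply: (IH m1 m) => //; subst m2; move: mn sq'; lia.
Qed.

Lemma ex_reduced_basis : (size l <= (size q).-1)%N -> exists m1 m2,
  [/\ (m1 <= m2)%N, size q = (i + m1 + m2).+1 & has_basis m1 m2].
Proof.
(* Weight bounds for the evident basis [(-l, 1)], [(q, 0)]. *)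
move=> sl; apply: (@has_basis_reduced ((size q).-1 - i.+1) ((size q).-1 - i)).
  by move: iq; lia.
exists (- l), q, 1, 0, (-1); split; split.
- by rewrite mulr1 addNr dvdp0.
- by rewrite mulr0 addr0.
- by rewrite oppr_eq0 oner_neq0.
- by rewrite scaleN1r mulr0 mulr1 sub0r.
- by rewrite size_polyN (leq_trans sl) //; move: iq; lia.
- by rewrite size_poly1.
- by move: iq; lia.
- by rewrite size_poly0.
Qed.

(** The determinant of [(u, v)] with the first basis vector is divisible by [q] but of smaller
    degree, so it is zero and the two vectors are proportional. The determinant with the second
    basis vector is divisible by [q] as well, which makes the factor a polynomial and bounds its
    degree. *)
Lemma short_vectors m1 m2 u1 u2 v1 v2 c m u v :
  lattice_basis m1 m2 u1 u2 v1 v2 c -> size q = (i + m1 + m2).+1 -> (m < m2)%N ->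
  (size u <= (i + m).+1)%N -> (size v <= m.+1)%N -> q %| u + l * v ->
  exists f : {poly k}, [/\ (size f <= m.+1 - m1)%N, u = f * u1 & v = f * v1].
Proof.
move=> [[q1 q2 c0 det] [s1 s2 s3 s4]] sq mm2 su sv quv.
have /dvdp_factor[w wE] : q %| u * v2 - u2 * v.
  rewrite (_ : _ - _ = (u + l * v) * v2 - (u2 + l * v2) * v); last by ring.
  by apply: dvdp_sub; apply: dvdp_mulr.
have z : u1 * v = u * v1.
  apply/eqP; rewrite -subr_eq0; apply: contraT => nz.
  have : q %| u1 * v - u * v1.
    rewrite (_ : _ - _ = (u1 + l * v1) * v - (u + l * v) * v1); last by ring.
    by apply: dvdp_sub; apply: dvdp_mulr.
  move/(dvdp_size_leq nz).
  have : (size (u1 * v - u * v1)%R <= (i + m1 + m).+1)%N.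
    apply: size_polyB_leq; first by apply: leq_trans (size_polyM_leq s1 sv) _; lia.
    by apply: leq_trans (size_polyM_leq su s2) _; lia.
  by move=> H1 H2; have := leq_trans H2 H1; rewrite sq; move: mm2; lia.
have cq0 : c *: q != 0 by rewrite scale_poly_eq0 negb_or c0.
have cancel a b : (c *: q) * a = b * (w * q) -> a = c^-1 *: w * b.
  move=> e; apply: (mulfI cq0); rewrite e -!scalerAl -scalerAr scalerA divff // scale1r.
  by ring.
exists (c^-1 *: w); split; first last.
- by apply: cancel; rewrite -det -wE; ring: z.
- by apply: cancel; rewrite -det -wE; ring: z.
suff sw : (size w <= m.+1 - m1)%N by rewrite size_scale ?invr_eq0.
have [->|w0] := eqVneq w 0; first by rewrite size_poly0.
have : (size (w * q)%R <= (i + m + m2).+1)%N.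
  rewrite -wE; apply: size_polyB_leq.
    by apply: leq_trans (size_polyM_leq su s4) _; lia.
  by apply: leq_trans (size_polyM_leq s3 sv) _; lia.
by rewrite size_polyM // sq; lia.
Qed.

End Lattice.

(** * The recurrence *)

Lemma PoszX a n : (a ^ n)%N%:Z = a%:Z ^+ n.
Proof. by rewrite -!natz natrX. Qed.

(** [fsum] picks an unspecified bound, so its value has to be independent of it. *)
Lemma fsumE (f : nat -> int) M : (forall k, (M <= k)%N -> f k = 0) ->
  fsum f = \sum_(k < M) f k.
Proof.
have ext M1 M2 : (M1 <= M2)%N -> (forall k, (M1 <= k)%N -> f k = 0) ->
    \sum_(k < M2) f k = \sum_(k < M1) f k.
  move=> M12 z; rewrite -(subnKC M12) big_split_ord /= [X in _ + X]big1 ?addr0 // => k _.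
  by rewrite z // leq_addr.
move=> fM; rewrite /fsum; case: excluded_middle_informative => [h|[]]; last by exists M.
case: constructive_indefinite_description => M' /= fM'.
by rewrite -(ext _ _ (leq_maxl M M') fM) -(ext _ _ (leq_maxr M M') fM').
Qed.

Section Recurrence.
Variable p : nat.
Hypothesis p_gt0 : (0 < p)%N.
Let P : int := p%:Z.

(* Number of the [p ^ d] neighbors, other than the one of type [i + d], of type [j]. *)
Definition aff_count (d i j : nat) : nat :=
  if (d <= i)%N then (p ^ d * (j == i - d))%N else
  if (i + j <= d)%N && ~~ odd (d - (i + j)) then
    if j == (d - i)%N then (p ^ i.+1)%N
    else if j == 0%N then ((p - 1) * p ^ (d - 1))%N
    else ((p ^ 2 - 1) * p ^ (d - 1 - j))%N
  else 0%N.

(** At [d = 0] the general expression would be twice the identity, hence the separate case. *)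
Definition nbr_count (d i j : nat) : nat :=
  if d == 0%N then (i == j : nat) else ((i + d == j) + aff_count d i j)%N.

Let A d i j : int := (aff_count d i j)%:Z.
Let N d i j : int := (nbr_count d i j)%:Z.

(* Right multiplication by [N 1], acting on a row. *)
Definition shift (r : nat -> int) (j : nat) : int :=
  (if j is j'.+1 then (1 + P * (j' == 0)%:Z) * r j' else 0) + P * r j.+1.

Let A_le d i j : (d <= i)%N -> A d i j = P ^+ d * (j == i - d)%N%:Z.
Proof. by move=> di; rewrite /A /aff_count di PoszM PoszX. Qed.

Let A_out d i j : (i < d)%N -> ~~ ((i + j <= d)%N && ~~ odd (d - (i + j))) ->
  A d i j = 0.
Proof. by move=> di nc; rewrite /A /aff_count leqNgt di /= (negPf nc). Qed.

Let A_diag d i j : (i < d)%N -> (i + j = d)%N -> A d i j = P ^+ i.+1.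
Proof.
move=> di e; rewrite /A /aff_count leqNgt di /= e leqnn subnn /=.
by have -> : (j == d - i)%N by [lia]; rewrite PoszX.
Qed.

Let A_mid d i j : (0 < j)%N -> (i + j < d)%N -> ~~ odd (d - (i + j)) ->
  A d i j = (P ^+ 2 - 1) * P ^+ (d - 1 - j).
Proof.
move=> j0 ijd ev; have di : (i < d)%N by lia.
rewrite /A /aff_count leqNgt di /= (ltnW ijd) ev /=.
have -> : (j == d - i)%N = false by lia.
by rewrite (gtn_eqF j0) PoszM PoszX -subzn ?expn_gt0 ?p_gt0 // PoszX.
Qed.

Let A_zero d i : (i < d)%N -> ~~ odd (d - i) -> A d i 0 = (P - 1) * P ^+ (d - 1).
Proof.
move=> di ev; rewrite /A /aff_count leqNgt di /= addn0 (ltnW di) ev /=.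
have -> : (0 == d - i)%N = false by lia.
by rewrite PoszM PoszX -subzn.
Qed.

(** [A 0] is the identity, so this recurrence has no exception at the start. The rows [i >= e + 2]
    are shifted diagonals and [i = e + 1], [i = e] are boundary rows. In the remaining rows an entry
    is zero by size or parity, lies on an antidiagonal [i + j = e + 2] or [i + j = e], or is
    interior. *)
Lemma aff_shift e i j : shift (A e.+1 i) j = A e.+2 i j + P * A e i j.
Proof.
have [ei|ie] := leqP e.+2 i.
  rewrite /shift; case: j => [|j]; (rewrite !A_le; [|lia..]).
    have -> : (0 == i - e)%N = false by lia.
    have -> : (1 == i - e.+1)%N = (0 == i - e.+2)%N by lia.
    by rewrite mulr0 add0r mulr0 addr0 [in RHS]exprS mulrA.
  have -> : (j.+1 == i - e)%N = (j == i - e.+1)%N by lia.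
  have -> : (j.+2 == i - e.+1)%N = (j.+1 == i - e.+2)%N by lia.
  have [j0|j0] := eqVneq j 0%N.
    have -> : (j == i - e.+1)%N = false by lia.
    by rewrite !mulr0 add0r addr0 [in RHS]exprS mulrA.
  by rewrite mulr0 addr0 mul1r addrC [in RHS]exprS !exprS; ring.
have [ei|ei] := eqVneq i e.+1.
  subst i; rewrite /shift (A_le _ (leqnSn e)) (A_le _ (leqnn _)) subnn.
  have -> : (e.+1 - e = 1)%N by lia.
  have [->|j1] := eqVneq j 1%N.
    rewrite (A_diag (d := e.+2)) ?addn1 // !(A_le _ (leqnn e.+1)) subnn /=.
    by rewrite !exprS; ring.
  rewrite A_out; [|lia|by case: j j1 => [|[|j]] // _; lia].
  case: j j1 => [|[|j]] // _; rewrite ?A_le ?subnn //=; ring.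
have [ei2|ei2] := eqVneq e i.
  subst i; rewrite (A_le _ (leqnn e)) subnn /shift.
  case: j => [|[|[|j]]].
  - rewrite (A_diag (j := 1)) ?addn1 // A_zero; [|lia..].
    by rewrite subn1 /= !exprS; ring.
  - by rewrite !A_out; [rewrite /=; ring|lia..].
  - rewrite (A_diag (j := 1)) ?addn1 // (A_diag (j := 2)) ?addn2 // A_out; [|lia..].
    by rewrite /= !exprS; ring.
  - by rewrite !A_out; [rewrite /=; ring|lia..].
have {ie ei ei2} ie : (i < e)%N by lia.
have [out|inr] := leqP (e.+3 - i) j.
  case: j out => [|j] out; first by lia.
  by rewrite /shift !A_out; [rewrite /=; ring|lia..].
have [od|ev] := boolP (odd (e.+2 - (i + j))).
  case: j inr od => [|j] inr od; rewrite /shift !A_out; first [lia | ring].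
have [eB|nB] := eqVneq j (e.+2 - i)%N.
  case: j eB ev inr => [|j] eB ev inr; first by lia.
  rewrite /shift (A_diag (j := j)); [|lia..].
  rewrite (A_diag (j := j.+1)); [|lia..].
  rewrite !A_out; [|lia..].
  have -> : (j == 0)%N = false by lia.
  by rewrite /=; ring.
have [eC|nC] := eqVneq j (e - i)%N.
  case: j eC ev inr nB => [|j] eC ev inr nB; first by lia.
  rewrite /shift (A_diag (j := j.+2)); [|lia..].
  rewrite (A_diag (j := j.+1) (d := e)); [|lia..].
  rewrite (A_mid (j := j.+1)); [|lia..].
  have -> : (e.+2 - 1 - j.+1 = i.+1)%N by lia.
  case: j eC ev inr nB => [|j] eC ev inr nB.
    rewrite A_zero; [|lia..]; have -> : (e.+1 - 1 = i.+1)%N by lia.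
    by rewrite /=; ring.
  rewrite A_mid; [|lia..]; have -> : (e.+1 - 1 - j.+1 = i.+1)%N by lia.
  by rewrite /=; ring.
case: j ev inr nB nC => [|j] ev inr nB nC.
  rewrite /shift A_mid; [|lia..]; rewrite !A_zero; [|lia..].
  case: e ie ev inr nB nC => [|e] ie ev inr nB nC; first by lia.
  have -> : (e.+2 - 1 - 1 = e)%N by lia.
  have -> : (e.+3 - 1 = e.+2)%N by lia.
  by rewrite /= !exprS; ring.
rewrite /shift !(A_mid (j := j.+1)); [|lia..]; rewrite (A_mid (j := j.+2)); [|lia..].
have -> : (e.+1 - 1 - j.+2 = e - 1 - j.+1)%N by lia.
have -> : (e.+2 - 1 - j.+1 = (e - 1 - j.+1).+2)%N by lia.
case: j ev inr nB nC => [|j] ev inr nB nC.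
  rewrite A_zero; [|lia..].
  have -> : (e.+1 - 1 = (e - 1 - 1).+2)%N by lia.
  by rewrite /= !exprS; ring.
rewrite A_mid; [|lia..].
have -> : (e.+1 - 1 - j.+1 = (e - 1 - j.+2).+2)%N by lia.
by rewrite /= !exprS; ring.
Qed.

Lemma shiftD (r r' : nat -> int) j :
  shift (fun j => r j + r' j) j = shift r j + shift r' j.
Proof. by rewrite /shift; case: j => [|j]; ring. Qed.

Lemma shiftZ c (r : nat -> int) j : shift (fun j => c * r j) j = c * shift r j.
Proof. by rewrite /shift; case: j => [|j]; ring. Qed.

Lemma shift_sum n (F : nat -> nat -> int) j :
  shift (fun j => \sum_(e < n) F e j) j = \sum_(e < n) shift (F e) j.
Proof.
elim: n => [|n IH].
  by rewrite big_ord0 /shift; case: j => [|j]; rewrite !big_ord0; ring.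
rewrite [RHS]big_ord_recr /= -IH -shiftD /shift.
by case: j {IH} => [|j]; rewrite !big_ord_recr.
Qed.

Let N_S e i j : N e.+1 i j = (i + e.+1 == j)%N%:Z + A e.+1 i j.
Proof. by []. Qed.

Let A0 i j : A 0 i j = (i == j)%N%:Z.
Proof. by rewrite A_le // subn0 mul1r eq_sym. Qed.

Lemma delta_shift e i j : shift (fun j => (i + e.+1 == j)%N%:Z) j =
  (i + e.+2 == j)%N%:Z + P * (i + e == j)%N%:Z.
Proof.
rewrite /shift addnS [(i + e.+2)%N]addnS addnS eqSS; case: j => [|j].
  by rewrite add0r.
rewrite !eqSS; have [->|_] := eqVneq j 0%N; last by rewrite mulr0 addr0 mul1r.
by rewrite /=; ring.
Qed.

(** Both the term [i + e = j] and [A] satisfy the same recurrence. For [e = 1] each of them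
    contributes [p] times the identity, whence the factor [2]. *)
Lemma count_shift e i j : shift (N e i) j =
  N e.+1 i j + P * (if e is e'.+1 then (1 + (e' == 0)%:Z) * N e' i j else 0).
Proof.
case: e => [|e].
  rewrite mulr0 addr0 N_S.
  have NE j' : N 0 i j' = (i == j')%N%:Z by [].
  case: i NE => [|i] NE.
    have [->|j1] := eqVneq j 1%N; first by rewrite A_diag // /shift !NE /=; ring.
    rewrite A_out; [|lia|by case: j j1 => [|[|j]] // _; lia].
    by rewrite /shift; case: j j1 => [|[|j]] // _; rewrite !NE /=; ring.
  rewrite A_le // subn1 /= /shift addn1; case: j => [|j]; rewrite !NE ?eqSS expr1.
    by rewrite eq_sym /=; ring.
  rewrite (eq_sym j.+1); have [->|_] := eqVneq j 0%N; first by rewrite /=; ring.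
  by rewrite mulr0 addr0 mul1r.
have -> : shift (N e.+1 i) j = shift (fun j => (i + e.+1 == j)%N%:Z) j + shift (A e.+1 i) j.
  by rewrite -shiftD /shift; case: j.
rewrite delta_shift aff_shift N_S; case: e => [|e].
  by rewrite addn0 A0 /N /nbr_count /=; ring.
by rewrite N_S /=; ring.
Qed.

Let N0 i j : N 0 i j = (i == j)%N%:Z. Proof. by []. Qed.

Lemma imul_shift (B : imat) i j : imul B (N 1) i j = shift (B i) j.
Proof.
have N1 k : N 1 k j = shift (N 0 k) j by rewrite count_shift mulr0 addr0.
(* Column [j] of [N 1] vanishes beyond row [j + 1]. *)
rewrite /imul (@fsumE _ j.+2) => [|k jk]; last first.
  rewrite N1 /shift; case: j jk {N1} => [|j] jk; rewrite !N0 ?(gtn_eqF jk) ?mulr0 ?addr0 //.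
  by rewrite (_ : (k == j) = false) ?mulr0 //; lia.
under eq_bigr => k _ do rewrite N1 -shiftZ.
rewrite -(shift_sum _ (fun k j' => B i k * N 0 k j')).
have S j' : (j' < j.+2)%N -> \sum_(k < j.+2) B i k * N 0 k j' = B i j'.
  move=> jj; rewrite (bigD1 (Ordinal jj)) //= N0 eqxx mulr1 big1 ?addr0 // => k nk.
  by rewrite N0 (_ : (nat_of_ord k == j') = false) ?mulr0 //; apply: contraNF nk => /eqP e;
    apply/eqP/val_inj.
by rewrite /shift; case: j {N1} S => [|j] S; rewrite !S //; lia.
Qed.

(** The coefficient of [N_e] in [N_1^d], indexed by [e = d - 2k] instead of [k] because
    multiplication by [N_1] moves [e] by one. *)
Definition pow_coef (d e : nat) : int :=
  if (e <= d)%N && ~~ odd (d - e) then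
    ('C(d, (d - e)./2))%:Z * P ^+ (d - e)./2 else 0.

Lemma pow_coefS d e : pow_coef d.+1 e =
  (if e is e'.+1 then pow_coef d e' else 0) + P * (1 + (e == 0)%N%:Z) * pow_coef d e.+1.
Proof.
rewrite /pow_coef; case: e => [|e].
  rewrite subn0 add0r leq0n /=; case: d => [|d]; first by rewrite mulr0.
  rewrite subn1 /= negbK.
  case: ifP => od; last by rewrite mulr0.
  rewrite binS -[X in 'C(d.+1, X)]/(d./2.+1).
  (* The two middle coefficients of an odd row agree, which absorbs the factor [2] at [e = 0]. *)
  have -> : 'C(d.+1, d./2.+1) = 'C(d.+1, d./2).
    by rewrite -bin_sub; [congr binomial|]; move: od; lia.
  by rewrite PoszD exprS /=; ring.
rewrite subSS ltnS; case: ifP => [/andP[ed ev]|nev]; last first.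
  by rewrite add0r (_ : (e.+1 < d)%N && _ = false) ?mulr0 //; lia.
have [k dk] : exists k, (d - e = 2 * k)%N by exists (d - e)./2; move: ev; lia.
have -> : ((d - e)./2 = k)%N by lia.
case: k dk => [|k] dk.
  by rewrite (_ : (e.+1 < d)%N && _ = false) ?mulr0 ?addr0 ?bin0 //; lia.
have -> : (e.+1 < d)%N && ~~ odd (d - e.+2) by lia.
have -> : ((d - e.+2)./2 = k)%N by lia.
by rewrite binS PoszD exprS /=; ring.
Qed.

Lemma ipow_count d i j : ipow (N 1) d i j = \sum_(e < d.+1) pow_coef d e * N e i j.
Proof.
elim: d j => [|d IH] j.
  by rewrite big_ord_recl big_ord0 /pow_coef /= addr0 !mul1r.
rewrite /= imul_shift.
have -> : shift (ipow (N 1) d i) j =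
    shift (fun j => \sum_(e < d.+1) pow_coef d e * N e i j) j.
  by rewrite /shift; case: j => [|j]; rewrite !IH.
rewrite (shift_sum _ (fun e j => pow_coef d e * N e i j)).
rewrite (eq_bigr (fun e : 'I_d.+1 => pow_coef d e * N e.+1 i j + pow_coef d e *
    (P * (if e : nat is e'.+1 then (1 + (e' == 0)%N%:Z) * N e' i j else 0)))); last first.
  by move=> e _; rewrite -mulrDr -count_shift -shiftZ.
rewrite big_split /=; under [RHS]eq_bigr => e _ do rewrite pow_coefS mulrDl.
rewrite [RHS]big_split /=; congr (_ + _).
  by rewrite [RHS]big_ord_recl /= mul0r add0r; apply: eq_bigr.
have z e : (d < e)%N -> pow_coef d e = 0.
  by move=> de; rewrite /pow_coef (leqNgt e) de.
rewrite big_ord_recl /= !mulr0 add0r [RHS]big_ord_recr /= [X in _ = X + _]big_ord_recr /= !z // !mulr0 !mul0r !addr0.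
by apply: eq_bigr => e _; rewrite /bump /= add1n; ring.
Qed.

Lemma sum_even n (G : nat -> int) : (forall r, (r <= n)%N -> odd r -> G r = 0) ->
  \sum_(r < n.+1) G r = \sum_(k < n./2.+1) G k.*2.
Proof.
elim: n => [|n IH] G0; first by rewrite !big_ord_recl !big_ord0.
rewrite big_ord_recr /= IH => [|r rn]; last by apply/G0/leqW.
 have [od|ev] := boolP (odd n).
  rewrite uphalf_half od /= add1n [RHS]big_ord_recr /=; congr (_ + G _).
  by rewrite doubleS -[in LHS](odd_double_half n) od.
by rewrite G0 //= addr0 uphalf_half (negPf ev).
Qed.

Lemma count_recurrence d i j : N d i j = ipow (N 1) d i j -
  \sum_(1 <= k < (d./2).+1) ('C(d, k) * p ^ k)%:Z * N (d - k.*2) i j.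
Proof.
rewrite ipow_count (reindex_inj rev_ord_inj) /=.
under eq_bigr => r _ do rewrite subSS.
rewrite (@sum_even d (fun r => pow_coef d (d - r) * N (d - r) i j)); last first.
  by move=> r rd od; rewrite /pow_coef leq_subr subKn // od mul0r.
have E k : (k <= d./2)%N -> pow_coef d (d - k.*2) * N (d - k.*2) i j =
    ('C(d, k) * p ^ k)%N%:Z * N (d - k.*2) i j.
  move=> kd; congr (_ * _); rewrite /pow_coef leq_subr.
  have k2d : (k.*2 <= d)%N by lia.
  by rewrite subKn // odd_double doubleK PoszM PoszX.
rewrite big_ord_recl /= E // double0 subn0 bin0 mul1n expn0 mul1r.
apply/eqP; rewrite eq_sym subr_eq addrC eq_sym; apply/eqP; rewrite addrC; congr (_ + _).
rewrite big_add1 big_mkord; apply: eq_bigr => k _.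
by rewrite -E // /bump add1n.
Qed.

End Recurrence.

(** * Counting by the first minimum *)

Lemma card_option_pred (T : finType) (pr : pred (option T)) :
  #|pr| = (pr None + #|[pred x | pr (Some x)]|)%N.
Proof.
rewrite (cardE pr) /enum_mem [in LHS]unlock /= filter_map.
rewrite (_ : (None \in pr) = pr None) //.
rewrite cardE /enum_mem size_filter.
by case: (pr None) => /=; rewrite size_map size_filter.
Qed.

Lemma Posz_sum (I : finType) (F : I -> nat) :
  (\sum_i F i)%N%:Z = \sum_i (F i)%:Z.
Proof. by rewrite -natz natr_sum; apply: eq_bigr => j _; rewrite natz. Qed.

Section Count.
Variables (k : finFieldType) (q : {poly k}) (i : nat).
Hypothesis irr : irreducible_poly q.
Let d := (size q).-1.
Hypothesis id : (i < d)%N.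

Let sizeq : size q = d.+1.
Proof. by rewrite /d prednK // size_poly_gt0 irredp_neq0. Qed.

(** As [m1 + m2 = d - i], the bound on [m] gives [m < m2], and [f] in [short_vectors] parametrises
    the pairs. For [m < m1] the truncated exponent is [0]: only the zero vector remains. *)
Lemma card_short_vectors (l : {poly k}) m1 m2 m : (m1 <= m2)%N ->
  size q = (i + m1 + m2).+1 -> has_basis q l i m1 m2 -> (2 * m < d - i)%N ->
  #|[pred w : {poly_((i + m).+1) k} * {poly_(m.+1) k} | q %| val w.1 + l * val w.2]|
    = (#|k| ^ (m.+1 - m1))%N.
Proof.
move=> m12 sq [u1 [u2 [v1 [v2 [c B]]]]] m2d.
have [[q1 _ c0 det] [s1 s2 _ _]] := B.
have iq : (i.+1 < size q)%N by rewrite sizeq.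
have mm2 : (m < m2)%N by move: sq m2d m12; rewrite sizeq; lia.
have szM (f a : {poly k}) n : (size f <= m.+1 - m1)%N -> (size a <= (n + m1).+1)%N ->
    (size (f * a)%R <= (n + m).+1)%N.
  have [m1m|mm1] := leqP m1 m.
    by move=> sf sa; apply: leq_trans (size_polyM_leq sf sa) _; lia.
  have -> : (m.+1 - m1 = 0)%N by lia.
  by rewrite leqn0 size_poly_eq0 => /eqP ->; rewrite mul0r size_poly0.
have su (f : {poly_(m.+1 - m1) k}) := szM _ _ i (size_npoly f) s1.
have sv (f : {poly_(m.+1 - m1) k}) := szM _ _ 0%N (size_npoly f) s2.
pose g f : {poly_((i + m).+1) k} * {poly_(m.+1) k} := (NPoly (su f), NPoly (sv f)).
have g_inj : injective g.
  move=> f f' [/= e1 e2]; apply: val_inj.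
  have [u10|u10] := eqVneq u1 0; last exact: (mulIf u10).
  have [v10|v10] := eqVneq v1 0; last exact: (mulIf v10).
  move/eqP: det; rewrite u10 v10 mulr0 mul0r subr0 eq_sym scale_poly_eq0 (negPf c0).
  by rewrite (negPf (irredp_neq0 irr)).
rewrite -card_npoly -(card_imset _ g_inj) -[RHS]cardsE; apply: eq_card => -[u v].
rewrite !inE /=; apply/idP/imsetP => [quv|[f _ [-> ->]]] /=.
  have [f [sf uE vE]] := short_vectors (irredp_neq0 irr) iq B sq mm2 (size_npoly u) (size_npoly v) quv.
  by exists (NPoly sf) => //; congr (_, _); apply: val_inj.
by rewrite mulrCA -mulrDr dvdp_mull.
Qed.

(** Below degree [d] a nonzero [v] is invertible modulo [q], and the only slope is the residue of
    [-u / v]; for [v = 0] the condition reads [u = 0]. *)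
Lemma card_slopes (u v : {poly k}) : (size u <= d)%N -> (size v <= d)%N ->
  #|[pred l : {poly_d k} | q %| u + val l * v]| =
    if v == 0 then if u == 0 then (#|k| ^ d)%N else 0%N else 1%N.
Proof.
move=> su sv; have small (w : {poly k}) : (size w <= d)%N -> q %| w -> w = 0.
  move=> sw qw; apply/eqP; apply: contraT => w0.
  by have := leq_trans (dvdp_size_leq w0 qw) sw; rewrite sizeq ltnn.
case: eqP => [->|/eqP v0].
  case: eqP => [->|/eqP u0].
    by rewrite -card_npoly; apply: eq_card => l; rewrite !inE mulr0 addr0 dvdp0.
  apply: eq_card0 => l; rewrite !inE mulr0 addr0; apply: contraNF u0 => qu.
  exact/eqP/small.
have co : coprimep q v.
  by apply: irreducible_coprime => //; apply: contra v0 => /(small _ sv) ->.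
have /Bezout_eq1_coprimepP[[x y] /= xy] := co.
have sl : (size (- (u * y) %% q)%R <= d)%N.
  by rewrite -ltnS -sizeq; apply: ltn_modpN0; apply: irredp_neq0.
rewrite -(card1 (NPoly sl)); apply: eq_card => l; rewrite !inE.
have E : q %| u + (- (u * y) %% q) * v.
  have e := divp_eq (- (u * y)) q; set r := _ %% q in e *; set w := _ %/ q in e.
  have -> : u + r * v = (u * x - w * v) * q.
    have -> : r = - (u * y) - w * q by rewrite e addrC addKr.
    by rewrite -{1}[u]mulr1 -xy; ring.
  exact: dvdp_mulIr.
apply/idP/eqP => [ql|->//]; apply/val_inj/eqP; rewrite -subr_eq0; apply/eqP/small.
  by apply: size_polyB_leq => //; apply: size_npoly.
rewrite -(Gauss_dvdpl _ co).
rewrite (_ : _ * v = (u + val l * v) - (u + (- (u * y) %% q) * v)); last by rewrite /=; ring.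
exact: dvdp_sub.
Qed.

Variable M : {poly_d k} -> nat.
Hypothesis M_basis : forall l, exists m2, [/\ (M l <= m2)%N,
  size q = (i + M l + m2).+1 & has_basis q (val l) i (M l) m2].

(** Double count of pairs of a vector of weight below [n] and a slope. The zero vector accounts for
    [#|k| ^ d], and the vectors with [v] nonzero for [#|k| ^ (i + 2 * n) - #|k| ^ (i + n)], written
    without subtraction. *)
Lemma sum_min_weight n : (2 * n < d - i + 2)%N ->
  (\sum_(l : {poly_d k}) #|k| ^ (n - M l) + #|k| ^ (i + n) = #|k| ^ d + #|k| ^ (i + 2 * n))%N.
Proof.
case: n => [|m] md.
  under eq_bigr => l _ do rewrite sub0n expn0.
  by rewrite sum1_card card_npoly muln0 !addn0.
have m2d : (2 * m < d - i)%N by lia.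
pose W := ({poly_((i + m).+1) k} * {poly_(m.+1) k})%type.
have -> : (\sum_(l : {poly_d k}) #|k| ^ (m.+1 - M l) =
  \sum_(l : {poly_d k}) \sum_(w : W) nat_of_bool (q %| val w.1 + val l * val w.2)%R)%N.
  apply: eq_bigr => l _; have [m2 [Mm2 sq B]] := M_basis l.
  by rewrite -(card_short_vectors Mm2 sq B m2d) -sum1_card big_mkcond.
rewrite exchange_big /=.
have sd n : (n <= (i + m).+1)%N -> (n <= d)%N by move: m2d; lia.
under eq_bigr => w _.
  have := card_slopes (sd _ (size_npoly w.1)) (sd _ (leq_trans (size_npoly w.2) _)).
  rewrite -sum1_card big_mkcond /= => ->; last by rewrite ltnS leq_addl.
  over.
rewrite -(pair_bigA _ (fun u v => if val v == 0%R then
  if val u == 0%R then #|k| ^ d else 0 else 1)%N) /= exchange_big /=.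
rewrite (bigD1 0) //= eqxx (bigD1 0) //= eqxx big1 ?addn0; last first.
  move=> u u0; have -> // : (val u == 0%R) = false by apply: contraNF u0 => /eqP e; apply/eqP/val_inj.
have -> : (\sum_(v : {poly_(m.+1) k} | v != 0%R) \sum_(u : {poly_((i + m).+1) k})
   (if val v == 0%R then if val u == 0%R then #|k| ^ d else 0 else 1) =
   \sum_(v : {poly_(m.+1) k} | v != 0%R) #|k| ^ (i + m).+1)%N.
  apply: eq_bigr => v v0; rewrite (eq_bigr (fun=> 1%N)) ?sum1_card ?card_npoly // => u _.
  have -> // : (val v == 0%R) = false by apply: contraNF v0 => /eqP e; apply/eqP/val_inj.
rewrite sum_nat_const -addnA; congr addn.
have := cardC1 (0 : {poly_(m.+1) k}); rewrite card_npoly => cc.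
rewrite (_ : #|_| = (#|k| ^ m.+1).-1)%N; last by rewrite -cc; apply: eq_card.
rewrite addnS -mulSnr prednK; last first.
  by rewrite expn_gt0; apply/orP; left; apply/card_gt0P; exists 0.
by rewrite -expnD; congr expn; lia.
Qed.

Let P : int := #|k|%:Z.
Let S n : int := \sum_(l : {poly_d k}) P ^+ (n - M l).

Let SE n : (2 * n < d - i + 2)%N -> S n = P ^+ d + P ^+ (i + 2 * n) - P ^+ (i + n).
Proof.
move=> nd; apply/eqP; rewrite eq_sym subr_eq eq_sym /P -!PoszX; apply/eqP.
rewrite -[X in _ = X]PoszD -sum_min_weight // PoszD; congr (_ + _).
by rewrite Posz_sum; apply: eq_bigr => l _; rewrite PoszX.
Qed.

Definition weight_count m := #|[pred l | M l == m]|.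

Let countE m : (weight_count m)%:Z = \sum_l (M l == m)%:Z.
Proof. by rewrite /weight_count -sum1_card big_mkcond Posz_sum. Qed.

Let card_k_gt0 : (0 < #|k|)%N.
Proof. by apply/card_gt0P; exists 0. Qed.

Let P1 : P - 1 != 0.
Proof.
have : (1 < #|k|)%N.
  rewrite (cardD1 0) (cardD1 1) !inE oner_neq0 //.
rewrite /P; lia.
Qed.

(** In [S 1 - S 0] only the slopes with [M l = 0] survive. *)
Lemma weight_count0 : weight_count 0 = (#|k| ^ i.+1)%N.
Proof.
apply/eqP; rewrite -eqz_nat; apply/eqP/(mulfI P1).
have -> : (P - 1) * (weight_count 0)%:Z = S 1 - S 0.
  rewrite countE /S -sumrB mulr_sumr; apply: eq_bigr => l _.
  by case: (M l) => [|x] /=; rewrite ?sub0n ?subn0 ?expr0 ?expr1 ?mulr1 ?mulr0 // subn1 expr0 subrr.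
by rewrite !SE ?PoszX -/P; [rewrite muln1 muln0 !addn0 addn1 addn2 !exprS; ring | lia | lia].
Qed.

(** In terms of the shift [T] of [n], the combination is [(T - 1) (T - P)]. On [P ^+ (n - M l)] it
    kills the geometric part [n >= M l] and the constant part [n <= M l], leaving only the
    corner. *)
Lemma weight_count_mid m : (0 < m)%N -> (2 * m < d - i)%N ->
  weight_count m = ((#|k| ^ 2 - 1) * #|k| ^ (i + 2 * m - 1))%N.
Proof.
case: m => // m _ md; apply/eqP; rewrite -eqz_nat; apply/eqP/(mulfI P1).
have -> : (P - 1) * (weight_count m.+1)%:Z = S m.+2 - (1 + P) * S m.+1 + P * S m.
  rewrite countE /S !mulr_sumr -sumrB -big_split /=; apply: eq_bigr => l _.
  have [lt|gt|->] := ltngtP (M l) m.+1.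
  - have -> : (m.+2 - M l = (m - M l).+2)%N by lia.
    by have -> : (m.+1 - M l = (m - M l).+1)%N by [lia]; rewrite mulr0 !exprS; ring.
  - have [-> ->] : (m.+2 - M l = 0 /\ m.+1 - M l = 0)%N by lia.
    by have -> : (m - M l = 0)%N by [lia]; rewrite mulr0 !expr0; ring.
  - have [-> ->] : (m.+2 - m.+1 = 1 /\ m.+1 - m.+1 = 0)%N by lia.
    by have -> : (m - m.+1 = 0)%N by [lia]; rewrite mulr1 expr1 !expr0; ring.
rewrite !SE; [|lia..]; rewrite PoszM PoszX -subzn ?expn_gt0 ?card_k_gt0 // PoszX -/P.
have -> : (i + 2 * m.+2 = (i + 2 * m).+4)%N by lia.
have -> : (i + 2 * m.+1 = (i + 2 * m).+2)%N by lia.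
have -> : (i + m.+2 = (i + m).+2)%N by lia.
by rewrite subn1 /= addnS !exprS; ring.
Qed.

(** The next sum is outside the range of [sum_min_weight], but no first minimum exceeds
    [(d - i) / 2], so the factor [T - P] alone isolates the largest value. *)
Lemma weight_count_top m : (0 < m)%N -> (2 * m = d - i)%N ->
  weight_count m = ((#|k| - 1) * #|k| ^ (d - 1))%N.
Proof.
case: m => // m _ md; apply/eqP; rewrite -eqz_nat; apply/eqP/(mulfI P1).
have -> : (P - 1) * (weight_count m.+1)%:Z = P * S m - S m.+1.
  rewrite countE /S !mulr_sumr -sumrB /=; apply: eq_bigr => l _.
  have : (M l <= m.+1)%N by have [m2 [Mm2]] := M_basis l; rewrite sizeq; lia.
  rewrite leq_eqVlt => /predU1P[->|lt].
    have -> : (m - m.+1 = 0)%N by lia.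
    by rewrite eqxx subnn expr0 !mulr1.
  rewrite (ltn_eqF lt); have -> : (m.+1 - M l = (m - M l).+1)%N by lia.
  by rewrite mulr0 exprS subrr.
rewrite !SE; [|lia..]; rewrite PoszM -subzn ?card_k_gt0 // PoszX -/P.
have dE : d = (i + 2 * m).+2 by lia.
have -> : (i + 2 * m.+1 = (i + 2 * m).+2)%N by lia.
by rewrite dE subn1 addnS !exprS; ring.
Qed.

End Count.

(** * Neighbor counts at an arbitrary place *)

Lemma card_aff_const p (T : finType) d i j (c : nat) : #|T| = (p ^ d)%N ->
  (p ^ d * (j == c))%N = aff_count p d i j ->
  #|[pred l : T | c == j]| = aff_count p d i j.
Proof.
move=> cT <-; rewrite [j == c]eq_sym; case: (c == j); last by rewrite muln0; apply: eq_card0.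
by rewrite muln1 -cT; apply: eq_card.
Qed.

Lemma card_aff_weight (k : finFieldType) (q : {poly k}) i j
    (M : {poly_((size q).-1) k} -> nat) : irreducible_poly q -> (i < (size q).-1)%N ->
  (forall l, exists m2, [/\ (M l <= m2)%N, size q = (i + M l + m2).+1 &
    has_basis q (val l) i (M l) m2]) ->
  #|[pred l | ((size q).-1 - i - 2 * M l)%N == j]| = aff_count #|k| (size q).-1 i j.
Proof.
move=> irr id MB; set d := (size q).-1 in M id MB *.
have Mle l : (2 * M l <= d - i)%N.
  by have [m2 [Mm2 sq _]] := MB l; rewrite /d sq; lia.
rewrite /aff_count leqNgt id /=; case: ifP => [/andP[ijd ev]|nc]; last first.
  apply: eq_card0 => l; rewrite !inE; apply: contraFF nc => /eqP e.
  by have := Mle l; lia.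
(* The type is [m2 - m1 = d - i - 2 m1], so type [j] means [m1 = (d - i - j) / 2]; this is the
   origin of the parity condition. *)
have [m mE] : exists m, (d - (i + j) = 2 * m)%N by exists (d - (i + j))./2; lia.
have -> : #|[pred l | (d - i - 2 * M l)%N == j]| = weight_count M m.
  by apply: eq_card => l; rewrite !inE; have := Mle l; lia.
case: eqP => [jE|jN].
  have -> : m = 0%N by lia.
  exact: (weight_count0 irr id MB).
have m0 : (0 < m)%N by lia.
case: eqP => [j0|j0]; first by apply: (weight_count_top irr id MB m0); lia.
rewrite (weight_count_mid irr id MB m0); last by lia.
by congr (_ * _ ^ _)%N; lia.
Qed.

(** At infinity, and at finite places of degree at most [i], all affine points give one type. Only
    for [i < deg q] does the type depend on the slope, through its first minimum. *)
Lemma N_is_nbr_count p (Q P : option {poly 'F_p}) i j : prime p ->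
  is_place Q -> place_deg Q = 1 -> is_place P ->
  N_is P (D_iQ Q i) (D_iQ Q j) (nbr_count p (place_deg P) i j).
Proof.
move=> pp plQ dQ plP; have cF := card_Fp pp.
have fromtyp (typ : option {poly_(place_deg P) 'F_p} -> nat) :
    (0 < place_deg P)%N -> typ None = (i + place_deg P)%N ->
    #|[pred l | typ (Some l) == j]| = aff_count p (place_deg P) i j ->
    (forall o, Xiso (fam (@upd p (@ainf p i) P o)) (fam (@ainf p (typ o)))) ->
    N_is P (D_iQ Q i) (D_iQ Q j) (nbr_count p (place_deg P) i j).
  move=> d0 tN tS iso; have := N_is_type j plQ dQ plP iso.
  by rewrite card_option_pred /= tN tS /nbr_count (gtn_eqF d0).
case: P plP fromtyp => [q|] plP fromtyp; last first.
  apply: (fromtyp (fun o => if o is Some _ then if i is i'.+1 then i' else 1%N else i.+1)).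
  - by [].
  - by rewrite addn1.
  - apply: card_aff_const; first by rewrite card_npoly cF.
    case: i {fromtyp} => [|i]; last by rewrite /aff_count /= subn1.
    by case: j => [|[|j]]; rewrite /aff_count /= ?muln0 ?muln1.
  - case=> [l|]; first exact: Xiso_nbr_inf_Some.
    exact: Xiso_nbr_inf_None.
have [_ iq] := plP; have q1 : (1 < size q)%N by case: iq.
have d0 : (0 < place_deg (Some q))%N by move: q1 => /=; lia.
have [di|id] := leqP (size q).-1 i.
  apply: (fromtyp (fun o => if o is Some _ then (i - (size q).-1)%N else (i + (size q).-1)%N)).
  - exact: d0.
  - by [].
  - apply: card_aff_const; first by rewrite card_npoly cF.
    by rewrite /aff_count /= di.
  - case=> [l|]; first exact: Xiso_nbr_fin_small.
    exact: Xiso_nbr_fin_None.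
have iq1 : (i.+1 < size q)%N by move: id; lia.
have [M MB] := fin_all_exists (fun l : {poly_((size q).-1) 'F_p} =>
  ex_reduced_basis (irredp_neq0 iq) iq1 (size_npoly l)).
apply: (fromtyp (fun o => if o is Some l then ((size q).-1 - i - 2 * M l)%N
  else (i + (size q).-1)%N)).
- exact: d0.
- by [].
- by have := card_aff_weight j iq id MB; rewrite cF.
- case=> [l|]; last exact: Xiso_nbr_fin_None.
  have [m2 [Mm2 sq [u1 [u2 [v1 [v2 [c [[q2 q3 c0 det] [s1 s2 s3 s4]]]]]]]]] := MB l.
  have -> : ((size q).-1 - i - 2 * M l = m2 - M l)%N by rewrite sq; lia.
  exact: (Xiso_nbr_fin_lattice plP q2 q3 c0 det s1 s2 s3 s4 Mm2 sq).
Qed.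

Theorem theorem5 (p : nat) (Q : option {poly 'F_p}) :
  prime p -> is_place Q -> place_deg Q = 1%N ->
  exists N : nat -> nat -> nat -> nat,
    [/\ (forall P, is_place P -> forall i j : nat,
           N_is P (D_iQ Q i) (D_iQ Q j) (N (place_deg P) i j)),
        (forall i j : nat, N 0%N i j = (i == j) :> nat)
      & (forall d : nat, (1 <= d)%N -> forall i j : nat,
           (N d i j)%:Z =
             ipow (fun a b => (N 1%N a b)%:Z) d i j
             - \sum_(1 <= k < (d./2).+1)
                 ('C(d, k) * p ^ k)%:Z * (N (d - k.*2)%N i j)%:Z)].
Proof.
move=> pp plQ dQ; exists (nbr_count p); split.
- by move=> P plP i j; apply: N_is_nbr_count.
- by [].
- move=> d _ i j; exact: (count_recurrence (prime_gt0 pp) d i j).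
Qed.
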